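(* Let $q$ be a prime power and $r\ge1$ an integer. Let $\mathcal{F}_{\le r}$ be the set of non-constant homogeneous $f\in\mathbb{F}_q[x,y,z]$ such that $C=\{f=0\}$ is a smooth plane curve tangent to every $\mathbb{F}_q$-line, and such that for every $\mathbb{F}_q$-line $L$ all points of tangency of $C$ with $L$ have degree at most $r$. Then \[ \overline{\mu}(\mathcal{F}_{\le r})\le(1-q^{-2})^{-(q^2+q+1)}\left(q^{-1}+q^{-2}-q^{-3}\right)^{q^2+q+1}. \]
   Context: Let $R=\mathbb{F}_q[x,y,z]$, $R_d$ the homogeneous polynomials of degree $d$ (including $0$), $\mu_d(\mathcal{A})=\#(\mathcal{A}\cap R_d)/\#R_d$, $\overline{\mu}(\mathcal{A})=\limsup_{d\to\infty}\mu_d(\mathcal{A})$. The degree of a point $P\in\mathbb{P}^2(\overline{\mathbb{F}}_q)$ is the degree over $\mathbb{F}_q$ of its field of definition (the residue field of the corresponding closed point). *)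

(* Defs.v *)
From HB Require Import structures.
From mathcomp Require Import all_boot all_order all_algebra all_field.
From mathcomp Require Import boolp.
From mathcomp Require Import mpoly.

Set Implicit Arguments.
Unset Strict Implicit.
Unset Printing Implicit Defensive.

Import Order.TTheory GRing.Theory Num.Theory.
Local Open Scope ring_scope.

Section PlaneCurves.
Variable F : finFieldType.

Definition evalL (L : fieldExtType F) (f : {mpoly F[3]}) (v : 'I_3 -> L) : L :=
  (map_mpoly (in_alg L) f).@[v].

(* a point of P^2(L) is represented by a nonzero triple of homogeneous coordinates *)
Definition nonzero_pt (L : fieldExtType F) (v : 'I_3 -> L) : Prop :=
  exists i, v i != 0.

Definition singular_pt (L : fieldExtType F) (f : {mpoly F[3]}) (v : 'I_3 -> L) : Prop :=
  evalL f v = 0 /\ forall i : 'I_3, evalL (f^`M(i)) v = 0.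

(* the plane curve {f = 0} is smooth: no singular point over the algebraic
   closure, i.e. over any finite extension L of F *)
Definition smooth_curve (f : {mpoly F[3]}) : Prop :=
  forall (L : fieldExtType F) (v : 'I_3 -> L), nonzero_pt v -> ~ singular_pt f v.

Definition on_line (L : fieldExtType F) (a : 'I_3 -> F) (v : 'I_3 -> L) : Prop :=
  \sum_(i < 3) in_alg L (a i) * v i = 0.

(* the curve {f = 0} is tangent at P = v to the line a: P lies on both, and
   the tangent line of C at P (with coefficient vector grad f (P), nonzero)
   is the line a *)
Definition tangent_at (L : fieldExtType F) (f : {mpoly F[3]}) (a : 'I_3 -> F)
    (v : 'I_3 -> L) : Prop :=
  [/\ nonzero_pt v, evalL f v = 0, on_line a v &
      exists2 lam : L, lam != 0 &
        forall i : 'I_3, evalL (f^`M(i)) v = lam * in_alg L (a i)].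

(* degree of a point P = v: degree over F of its field of definition
   F(v_i / v_j), for any j with v_j != 0 *)
Definition pt_deg (L : fieldExtType F) (v : 'I_3 -> L) : nat :=
  let j := odflt ord0 [pick j | v j != 0] in
  \dim <<1%VS & [seq v i / v j | i <- enum 'I_3]>>%VS.

Definition F_line (a : 'I_3 -> F) : Prop := exists i, a i != 0.

Definition Fle (r : nat) (f : {mpoly F[3]}) : Prop :=
  [/\ (exists d, f \is d.-homog),
      ~ (exists c : F, f = c%:MP),
      smooth_curve f,
      (forall a, F_line a ->
         exists (L : fieldExtType F) (v : 'I_3 -> L), tangent_at f a v) &
      (forall a, F_line a -> forall (L : fieldExtType F) (v : 'I_3 -> L),
         tangent_at f a v -> (pt_deg v <= r)%N)].

Definition Rd (d : nat) := finvect_type (dhomog 3 F d).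

Definition mu_d (A : {mpoly F[3]} -> Prop) (d : nat) : rat :=
  (#|[set p : Rd d | `[< A (mpoly_of_dhomog (p : dhomog 3 F d)) >] ]|%:R
     / #|{: Rd d}|%:R).

End PlaneCurves.

(* Main.v *)
Require Import Defs.
From HB Require Import structures.
From mathcomp Require Import all_boot all_order all_algebra all_field.
From mathcomp Require Import boolp.
From mathcomp Require Import ring lra zify.
From mathcomp Require mpoly.

(* Only finitely many local conditions matter: the first-order jet of [f] at
   each F-point of the plane, and, for each F-line, the restriction of [f]
   modulo [M ^ 2], where [M] is divisible by all polynomials of degree at most
   [r] without roots in [F].  For large [d] the map from forms of degree [d] to
   these data is onto, so the data are uniformly distributed.

   A smooth [f] is tangent to at most one of the q + 1 lines through an F-point
   [u].  Up to a factor (1 - q^-2)^-1, the weights of its possible jets at [u]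
   are dominated by those of q + 1 independent Bernoulli variables of parameter
   q^-2, one per line.  After this replacement the conditions on different lines
   become independent, and the probability of not being tangent to a given line
   is at least that of a univariate polynomial being squarefree (at least
   1 - q^-1), times the factor 1 - q^-2 of the point at infinity. *)

Import Order.TTheory GRing.Theory Num.Theory.
Local Open Scope ring_scope.

Module Forms.
Import mpoly.
Set Implicit Arguments.
Unset Strict Implicit.
Unset Printing Implicit Defensive.

(** * Counting *)

(** All fibres of [phi] are translates of the one over [phi 0], so the values of [phi] are
    equidistributed in [B]. The hypothesis is the form in which surjectivity of an additive map gets
    used. *)
Lemma card_preim_translate (A : finZmodType) (B : finType) (phi : A -> B)
    (Q : pred B) :
  (forall b, exists t, forall x, (phi x == b) = (phi (x - t) == phi 0)) ->
  (#|[pred x | Q (phi x)]| * #|B| = #|A| * #|Q|)%N.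
Proof.
move=> phiP; pose k := #|[pred x | phi x == phi 0]|.
have fibk b : #|[pred x | phi x == b]| = k.
  have [t tP] := phiP b; rewrite /k -[RHS](card_image (addIr t)).
  apply: eq_card => x; rewrite inE tP; apply/idP/imageP => [xt|[y + ->]].
    by exists (x - t); rewrite ?subrK.
  by rewrite inE addrK.
have cardQ (S : pred B) : #|[pred x | S (phi x)]| = (#|S| * k)%N.
  rewrite -[LHS]sum1_card (partition_big phi S) /= => [|//].
  rewrite -sum_nat_const; apply: eq_bigr => b Sb.
  rewrite sum1_card -(fibk b); apply: eq_card => x; rewrite !inE unfold_in /=.
  by apply: andb_idl => /eqP xb; rewrite inE xb.
have -> : #|A| = (#|B| * k)%N.
  by rewrite -(cardQ predT); apply: eq_card.
by rewrite cardQ mulnC mulnA mulnAC.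
Qed.

(** Think of points [P], lines [A], jets [J], and [tau] giving the tangent line of a jet. Jet counts
    are dominated by independent Bernoulli variables of parameter [b], one per incident pair; the
    sum then factors over the lines, and a line is missed at all its [n.+1] points with probability
    [(1 - b) ^+ n.+1]. *)
Lemma sum_hit_bound (R : realFieldType) (P A J : finType)
    (inc : P -> A -> bool) (tau : P -> J -> option A) (ok : pred J)
    (b al C : R) (n : nat) :
  0 <= b <= 1 -> 0 <= al <= 1 -> 0 <= C ->
  (forall p, #|[pred a | inc p a]| = n.+1) ->
  (forall a, #|[pred p | inc p a]| = n.+1) ->
  (forall p, #|[pred x | ok x & tau p x == None]|%:R <= C * (1 - b) ^+ n.+1) ->
  (forall p a, #|[pred x | ok x & tau p x == Some a]|%:R
     <= if inc p a then C * (b * (1 - b) ^+ n) else 0) ->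
  \sum_(j : {ffun P -> J} | [forall p, ok (j p)])
     \prod_a (if [exists p, tau p (j p) == Some a] then 1 else al)
  <= C ^+ #|P| * (1 - (1 - al) * (1 - b) ^+ n.+1) ^+ #|A|.
Proof.
move=> /andP[b0 b1] /andP[al0 al1] C0 incP incA tauN tauS.
have b'0 : 0 <= 1 - b by rewrite subr_ge0.
(* For a non-incident pair the variable is constantly false. *)
pose beta p a e : R :=
  if inc p a then (if e then b else 1 - b) else (if e then 0 else 1).
have beta0 p a e : 0 <= beta p a e.
  by rewrite /beta; case: ifP; case: e.
pose hit (T : P -> option A) a : R := if [exists p, T p == Some a] then 1 else al.
have hit0 T a : 0 <= hit T a by rewrite /hit; case: ifP.
pose cnt p t : R := #|[pred x | ok x & tau p x == t]|%:R.
have cntE p t : cnt p t <= C * \prod_a beta p a (t == Some a).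
  case: t => [a|]; last first.
    apply: le_trans (tauN p) _; rewrite ler_wpM2l //.
    rewrite (bigID (inc p)) /= [X in _ <= _ * X]big1 => [|a /negPf Ha]; last first.
      by rewrite /beta Ha.
    rewrite mulr1 (eq_bigr (fun=> 1 - b)) => [|a Ha]; last by rewrite /beta Ha.
    by rewrite prodr_const incP.
  apply: le_trans (tauS p a) _; case: ifP => [pa|_]; last first.
    by rewrite mulr_ge0 // prodr_ge0.
  rewrite ler_wpM2l // (bigD1 a) //= {1}/beta pa eqxx ler_wpM2l //.
  rewrite (bigID (inc p)) /= [X in _ <= _ * X]big1 => [|a' /andP[aa' /negPf Ha]].
    rewrite mulr1 (eq_bigr (fun=> 1 - b)) => [|a' /andP[aa' Ha]].
      rewrite prodr_const (_ : #|_| = n) //.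
      have := cardD1 a [pred a | inc p a]; rewrite incP inE pa add1n => -[->].
      by apply: eq_card => x; rewrite !inE andbC.
    by rewrite /beta Ha [_ == _](_ : _ = false) //; apply: contraNF aa' => /eqP[->].
  by rewrite /beta Ha [_ == _](_ : _ = false) //; apply: contraNF aa' => /eqP[->].
(* Families of jets are grouped by their tangent lines [T]; the choices at distinct points are
   independent. *)
have -> : \sum_(j : {ffun P -> J} | [forall p, ok (j p)])
     \prod_a (if [exists p, tau p (j p) == Some a] then 1 else al) =
   \sum_(T : {ffun P -> option A}) (\prod_p cnt p (T p)) * \prod_a hit T a.
  rewrite (partition_big (fun j : {ffun P -> J} => [ffun p => tau p (j p)]) predT) //=.
  apply: eq_bigr => T _; rewrite (eq_bigr (fun=> \prod_a hit T a)); last first.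
    move=> j /andP[_ /eqP <-]; apply: eq_bigr => a _; rewrite /hit.
    by congr (if _ then _ else _); apply: eq_existsb => p; rewrite ffunE.
  rewrite -(mul1r (\prod_a hit T a)) -mulr_suml mul1r; congr (_ * _).
  rewrite (eq_bigr (fun p => \sum_(x | ok x && (tau p x == T p)) 1)); last first.
    by move=> p _; rewrite /cnt sumr_const.
  rewrite bigA_distr_big_dep; apply: eq_big => [j|j _]; last first.
    by rewrite big1.
  apply/andP/familyP => [[/forallP okj /eqP TE] p|jT].
    by rewrite unfold_in /= okj -TE ffunE /=.
  split; first by apply/forallP => p; have := jT p; rewrite unfold_in => /andP[].
  apply/eqP/ffunP => p; rewrite ffunE; have := jT p.
  by rewrite unfold_in => /andP[_ /eqP].
(* [T] is encoded as a 0/1 matrix with at most one true entry per point. *)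
pose E (T : {ffun P -> option A}) : {ffun A -> {ffun P -> bool}} :=
  [ffun a => [ffun p => T p == Some a]].
have Einj : injective E.
  move=> T1 T2 /ffunP e; apply/ffunP => p.
  case e1 : (T1 p) => [a|].
    have := e a; rewrite !ffunE => /ffunP/(_ p); rewrite !ffunE e1 eqxx.
    by move/esym/eqP.
  case e2 : (T2 p) => [a|] //.
  have := e a; rewrite !ffunE => /ffunP/(_ p); rewrite !ffunE e2 eqxx.
  by move/eqP; rewrite e1.
pose g a (e : {ffun P -> bool}) : R :=
  (\prod_p beta p a (e p)) * (if [exists p, e p] then 1 else al).
have g0 a e : 0 <= g a e.
  by rewrite mulr_ge0 ?prodr_ge0 //; case: ifP.
apply: (@le_trans _ _ (C ^+ #|P| *
    \sum_(T : {ffun P -> option A}) \prod_a g a (E T a))).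
  rewrite mulr_sumr; apply: ler_sum => T _.
  apply: (@le_trans _ _ ((\prod_p (C * \prod_a beta p a (T p == Some a)))
                        * \prod_a hit T a)).
    apply: ler_wpM2r; first by rewrite prodr_ge0.
    by apply: ler_prod => p _; rewrite cntE ler0n.
  rewrite big_split /= prodr_const -mulrA ler_wpM2l ?exprn_ge0 //.
  rewrite exchange_big /= -big_split /= le_eqVlt; apply/orP; left; apply/eqP.
  apply: eq_bigr => a _; rewrite /g !ffunE; congr (_ * _).
    by apply: eq_bigr => p _; rewrite ffunE.
  rewrite /hit; congr (if _ then _ else _).
  by apply: eq_existsb => p; rewrite ffunE.
rewrite ler_wpM2l ?exprn_ge0 //.
rewrite -(big_imset (fun e : {ffun A -> {ffun P -> bool}} => \prod_a g a (e a))
   (h := E) (A := predT)) /=; last exact: in2W Einj.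
(* Allowing all matrices, not only those of the form [E T], adds nonnegative terms and makes the sum
   a product over lines. *)
apply: (@le_trans _ _ (\sum_(e : {ffun A -> {ffun P -> bool}}) \prod_a g a (e a))).
  rewrite [X in _ <= X](bigID (mem (E @: predT))) /= lerDl.
  by apply: sumr_ge0 => e _; apply: prodr_ge0.
rewrite -(bigA_distr_bigA g) /= (eq_bigr (fun=> 1 - (1 - al) * (1 - b) ^+ n.+1)).
  by rewrite prodr_const.
(* Only the zero vector leaves the line unhit, hence weighted by [al]; the total mass is 1. *)
move=> a _; pose z : {ffun P -> bool} := [ffun=> false].
have zE : \prod_p beta p a (z p) = (1 - b) ^+ n.+1.
  rewrite (bigID (inc^~ a)) /= [X in _ * X]big1 => [|p /negPf Ha]; last first.
    by rewrite /beta Ha ffunE.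
  rewrite mulr1 (eq_bigr (fun=> 1 - b)) => [|p Ha]; last by rewrite /beta Ha ffunE.
  by rewrite prodr_const incA.
have sumb : \sum_(e : {ffun P -> bool}) \prod_p beta p a (e p) = 1.
  rewrite -(bigA_distr_bigA (beta^~ a)) big1 // => p _; rewrite big_bool /beta /=.
  by case: ifP => _; rewrite ?add0r // addrCA subrr addr0.
rewrite (bigD1 z) //= {1}/g zE.
have -> : [exists p, z p] = false by apply/existsP => -[p]; rewrite ffunE.
rewrite (eq_bigr (fun e : {ffun P -> bool} => \prod_p beta p a (e p))).
  move: sumb; rewrite (bigD1 z) //= zE => /(canRL (addKr _)) ->.
  by ring.
move=> e ez; rewrite /g; have -> : [exists p, e p]; last by rewrite mulr1.
apply: contraR ez => /existsPn ez; apply/eqP/ffunP => p.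
by rewrite ffunE; apply/negbTE/ez.
Qed.

(** * Squarefree polynomials *)

Definition sqfree (K : fieldType) (p : {poly K}) : Prop :=
  forall g : {poly K}, g ^+ 2 %| p -> (size g <= 1)%N.

Lemma sqfree_neq0 (K : fieldType) (p : {poly K}) : sqfree p -> p != 0.
Proof.
move=> sp; apply/eqP => p0; have := sp 'X.
by rewrite p0 dvdp0 size_polyX => /(_ isT).
Qed.

Lemma size_sqrM (K : fieldType) (g h : {poly K}) : g != 0 -> h != 0 ->
  size (g ^+ 2 * h) = ((size g).-1 * 2 + size h)%N.
Proof.
move=> g0 h0; have := g0; rewrite -size_poly_gt0.
rewrite size_mul ?expf_neq0 // expr2 size_mul //.
by set a := size g; set b := size h; lia.
Qed.

(** Square factors are split off by induction on the degree; leading coefficients are moved into [h]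
    to keep [g] monic. *)
Lemma sqfree_decomp (K : fieldType) (p : {poly K}) : p != 0 ->
  exists g h : {poly K}, [/\ g \is monic, sqfree h & p = g ^+ 2 * h].
Proof.
have [n] := ubnP (size p); elim: n => // n IHn in p * => szp p0.
have [sp|/existsNP[g /not_implyP[gp /negP]]] := pselect (sqfree p).
  by exists 1, p; rewrite monic1 expr1n mul1r.
rewrite -ltnNge => szg.
have g0 : g != 0 by rewrite -size_poly_gt0 ltnW.
have lg0 : lead_coef g != 0 by rewrite lead_coef_eq0.
have {gp} [k pE] : exists k : {poly K}, p = k * g ^+ 2 by exact/dvdpP.
have k0 : k != 0 by apply: contraNneq p0 => k0; rewrite pE k0 mul0r.
have [||g1 [h [g1m hs kE]]] := IHn k; [| by [] |].
  by have := szp; rewrite pE mulrC size_sqrM //; set a := size k; set b := size g; lia.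
exists (g1 * ((lead_coef g)^-1 *: g)), (lead_coef g ^+ 2 *: h); split.
- by rewrite monicE lead_coefM lead_coefZ (monicP g1m) mul1r mulVf.
- move=> f; rewrite dvdpZr ?expf_neq0 //; exact: hs.
- have cE : (lead_coef g ^+ 2)%:P * (lead_coef g)^-1%:P ^+ 2 = 1 :> {poly K}.
    by rewrite -polyC_exp -polyCM exprVn divff ?expf_neq0.
  by rewrite pE kE -!mul_polyC -[LHS]mul1r -cE; ring.
Qed.

(** After division by the gcd [d], each of the coprime cofactors of [g1] and [g2] has its square
    dividing a squarefree polynomial, so it is constant. *)
Lemma sqfree_decomp_uniq (K : fieldType) (g1 g2 h1 h2 : {poly K}) :
  g1 \is monic -> g2 \is monic -> sqfree h1 -> sqfree h2 ->
  g1 ^+ 2 * h1 = g2 ^+ 2 * h2 -> g1 = g2.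
Proof.
move=> g1m g2m s1 s2 e.
have [g10 g20] := (monic_neq0 g1m, monic_neq0 g2m).
pose d := gcdp g1 g2.
have d0 : d != 0 by rewrite gcdp_eq0 (negPf g10).
have [d1 d2] : d %| g1 /\ d %| g2 by rewrite dvdp_gcdl dvdp_gcdr.
have cop : coprimep (g1 %/ d) (g2 %/ d) by rewrite coprimep_div_gcd ?g10.
have {}e : (g1 %/ d) ^+ 2 * h1 = (g2 %/ d) ^+ 2 * h2.
  apply: (mulfI (expf_neq0 2 d0)); move: e.
  rewrite -{1}(divpK d1) -{1}(divpK d2) => e.
  by transitivity ((g1 %/ d * d) ^+ 2 * h1); [ring | rewrite e; ring].
have sz1 : (size (g1 %/ d)%R <= 1)%N.
  apply: s2; rewrite -(Gauss_dvdpr _ (coprimep_expl 2 (coprimep_expr 2 cop))) -e.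
  exact: dvdp_mulr.
have sz2 : (size (g2 %/ d)%R <= 1)%N.
  apply: s1; rewrite coprimep_sym in cop.
  rewrite -(Gauss_dvdpr _ (coprimep_expl 2 (coprimep_expr 2 cop))) e.
  exact: dvdp_mulr.
have eqd (g : {poly K}) : g \is monic -> d %| g -> (size (g %/ d)%R <= 1)%N ->
    g = (lead_coef d)^-1 *: d.
  move=> gm dg /size1_polyC gdE.
  have gE : g = (g %/ d)`_0 *: d by rewrite -mul_polyC -gdE divpK.
  move: gm; rewrite {1}gE monicE lead_coefZ => /eqP c1.
  by rewrite {1}gE -(mulfK (x := lead_coef d) _ (g %/ d)`_0) ?lead_coef_eq0 // c1 mul1r.
by rewrite (eqd _ g1m d1 sz1) [RHS](eqd _ g2m d2 sz2).
Qed.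

Lemma size_rVpoly_leq (K : fieldType) (n : nat) (v : 'rV[K]_n) : (size (rVpoly v) <= n)%N.
Proof. exact: size_poly. Qed.

(* [g ^+ 2 * h], with [h] squarefree and [g] monic non-constant, is encoded by
   the constant coefficient of [g] together with [drop_poly 1 g ^+ 2 * h],
   whose degree is smaller by 2. *)
Lemma card_not_sqfree (F : finFieldType) (n : nat) :
  (#|[pred v : 'rV[F]_n.+2 | `[< ~ sqfree (rVpoly v) >]]| <= #|F| ^ n.+1)%N.
Proof.
pose rel (v : 'rV[F]_n.+2) (cw : 'rV[F]_1 * 'rV[F]_n) :=
  ~ sqfree (rVpoly v) ->
  if v == 0 then cw = 0 :> _ * _ else
  exists g h : {poly F}, [/\ g \is monic, sqfree h, (1 < size g)%N,
    rVpoly v = g ^+ 2 * h & cw.1 = (g`_0)%:M /\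
      rVpoly cw.2 = (drop_poly 1 g) ^+ 2 * h].
have dropm (g : {poly F}) : g \is monic -> (1 < size g)%N -> drop_poly 1 g \is monic.
  move=> gm szg; rewrite monicE lead_coefE size_drop_poly coef_drop_poly.
  by rewrite subn1 addn1 (ltn_predK (m := 0%N)) -?lead_coefE -?monicE // -subn1 subn_gt0.
have [phi phiP] : {phi & forall v, rel v (phi v)}.
  apply: choice => v; have [nsv|sv] := pselect (~ sqfree (rVpoly v)); last by exists 0.
  rewrite /rel; have [->|v0] := eqVneq v 0; first by exists 0.
  have pv0 : rVpoly v != 0.
    by apply: contraNneq v0 => e; rewrite -[v]rVpolyK e linear0.
  have [g [h [gm hs pE]]] := sqfree_decomp pv0.
  have szg : (1 < size g)%N.
    rewrite ltnNge; apply/negP => /size1_polyC gE; apply: nsv.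
    move: gm hs; rewrite pE gE monicE lead_coefC => /eqP ->.
    by rewrite expr1n mul1r.
  have [g0 h0] := (monic_neq0 gm, sqfree_neq0 hs).
  have szg0 := monic_neq0 (dropm _ gm szg).
  exists ((g`_0)%:M, poly_rV (drop_poly 1 g ^+ 2 * h)) => _; exists g, h; split=> //.
  split=> //; apply: poly_rV_K.
  have := size_rVpoly_leq v; rewrite pE !size_sqrM // size_drop_poly; move: szg.
  by set a := size g; set b := size h; lia.
have -> : (#|F| ^ n.+1 = #|{: 'rV[F]_1 * 'rV[F]_n}|)%N.
  by rewrite card_prod !card_mx !mul1n expnS expn1.
apply: (@leq_card_in _ _ phi) => v1 v2; rewrite !inE => /asboolP n1 /asboolP n2 e.
have := (phiP v1 n1, phiP v2 n2); rewrite -e.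
(* The code [0] is kept for the zero polynomial: every other code has a nonzero second component. *)
have H0 (x : 'rV[F]_1 * 'rV[F]_n) (v : 'rV[F]_n.+2) : x = 0 ->
    ~ exists g h : {poly F}, [/\ g \is monic, sqfree h, (1 < size g)%N,
        rVpoly v = g ^+ 2 * h & x.1 = (g`_0)%:M /\
          rVpoly x.2 = (drop_poly 1 g) ^+ 2 * h].
  move=> -> [g [h [gm hs szg _ [_ /esym/eqP]]]].
  rewrite linear0 mulf_eq0 expf_eq0 /= (negPf (sqfree_neq0 hs)) orbF.
  by apply/negP/monic_neq0/dropm.
have [->|v10] := eqVneq v1 0; have [->|v20] := eqVneq v2 0 => //.
- by case=> x0 /(H0 _ _ x0).
- by case=> /[swap] x0 /(H0 _ _ x0).
case=> -[g1 [h1 [g1m hs1 sz1 E1 [c1 w1]]]] [g2 [h2 [g2m hs2 sz2 E2 [c2 w2]]]].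
have ed : drop_poly 1 g1 = drop_poly 1 g2.
  apply: sqfree_decomp_uniq hs1 hs2 _; [exact: dropm|exact: dropm|].
  by rewrite -w1 -w2.
have eg : g1 = g2.
  apply: (eqp_take_drop (n := 1) _ ed); apply/polyP => i; rewrite !coef_take_poly.
  case: ifP => //; rewrite ltnS leqn0 => /eqP ->.
  by have := c1; rewrite c2 => /matrixP/(_ 0 0); rewrite !mxE !eqxx !mulr1n.
have eh : h1 = h2.
  have d0 := monic_neq0 (dropm _ g1m sz1).
  by apply: (mulfI (expf_neq0 2 d0)); rewrite -w1 w2 ed.
by rewrite -[v1]rVpolyK E1 eg eh -E2 rVpolyK.
Qed.

(** This condition depends only on [p] modulo [M ^+ 2], because [g ^+ 2] divides [M ^+ 2]. *)
Definition sqdiv (K : fieldType) (M p : {poly K}) : Prop :=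
  exists g : {poly K}, [/\ (1 < size g)%N, g %| M & g ^+ 2 %| p].

Lemma dvdp_prod_XsubC2 (K : fieldType) (p : {poly K}) (s : seq K) : uniq s ->
  (forall c, c \in s -> ('X - c%:P) ^+ 2 %| p) ->
  \prod_(c <- s) ('X - c%:P) ^+ 2 %| p.
Proof.
elim: s => [|c s IHs] /=; first by rewrite big_nil dvd1p.
case/andP=> cs us sp; rewrite big_cons Gauss_dvdp ?sp ?mem_head //=.
  by apply: IHs => // d ds; rewrite sp // inE ds orbT.
rewrite prodrXl; apply/coprimep_expl/coprimep_expr; rewrite coprimep_sym.
by rewrite coprimep_XsubC root_prod_XsubC.
Qed.

(** By Chinese remainders, a polynomial of degree less than [k + 2 * q] is determined by its
    residues modulo [M ^+ 2] and modulo the [q] squares [('X - c%:P) ^+ 2]. If it is squarefree, the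
    first residue is not [sqdiv] and the others are nonzero. Squarefree polynomials are then counted
    from below by [card_not_sqfree]. *)
Lemma card_not_sqdiv (F : finFieldType) (M : {poly F}) (k : nat) : let q := #|F| in
  M != 0 -> (forall c, ~~ root M c) -> size (M ^+ 2) = k.+1 ->
  (q ^ (k + 2 * q) <=
   #|[pred v : 'rV[F]_k | `[< ~ sqdiv M (rVpoly v) >]]| * (q ^ 2 - 1) ^ q
   + q ^ (k + 2 * q).-1)%N.
Proof.
move=> q M0 rM szM.
have q1 : (1 < q)%N by apply: finNzRing_gt1.
have [m mE] : exists m, (k + 2 * q = m.+2)%N by exists (k + 2 * q - 2)%N; lia.
rewrite mE /=; apply: leq_trans (leq_add (leqnn _) (card_not_sqfree F m)).
set S := [pred v : 'rV[F]_m.+2 | _].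
have -> : (q ^ m.+2 = #|[predC S]| + #|S|)%N.
  by rewrite addnC cardC card_mx mul1n.
rewrite leq_add2r.
have M20 : M ^+ 2 != 0 by rewrite expf_neq0.
have szX (c : F) : size (('X - c%:P) ^+ 2) = 3 by rewrite size_exp_XsubC.
have X0 (c : F) : ('X - c%:P) ^+ 2 != 0 by rewrite -size_poly_gt0 szX.
pose psi (v : 'rV[F]_m.+2) : 'rV[F]_k * {ffun F -> 'rV[F]_2} :=
  (poly_rV (rVpoly v %% M ^+ 2), [ffun c => poly_rV (rVpoly v %% ('X - c%:P) ^+ 2)]).
have psi1 v : rVpoly (psi v).1 = rVpoly v %% M ^+ 2.
  by rewrite poly_rV_K // -ltnS -szM ltn_modp.
have psi2 v c : rVpoly ((psi v).2 c) = rVpoly v %% ('X - c%:P) ^+ 2.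
  rewrite ffunE poly_rV_K // -ltnS.
  by have := ltn_modp (rVpoly v) (('X - c%:P) ^+ 2); rewrite X0 szX.
(* The difference is divisible by a polynomial of degree [k + 2 * q], and its own degree is
   smaller. *)
have psi_inj : injective psi.
  move=> v w e; apply: (can_inj rVpolyK); apply/eqP; rewrite -subr_eq0.
  set D := _ - _.
  have szD : (size D <= k + 2 * q)%N.
    by rewrite mE (leq_trans (size_polyD _ _)) // size_polyN geq_max !size_rVpoly_leq.
  have dM : M ^+ 2 %| D.
    by apply/modp_eq0P; rewrite modpD modpN -!psi1 e subrr.
  have dX : \prod_(c <- enum F) ('X - c%:P) ^+ 2 %| D.
    apply: dvdp_prod_XsubC2 => [|c _]; first exact: enum_uniq.
    by apply/modp_eq0P; rewrite modpD modpN -!psi2 e subrr.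
  have : M ^+ 2 * \prod_(c <- enum F) ('X - c%:P) ^+ 2 %| D.
    rewrite Gauss_dvdp ?dM //.
    rewrite big_seq; elim/big_ind: _ => [|x y cx cy|c _]; first exact: coprimep1.
      by rewrite coprimepMr cx.
    by apply/coprimep_expl/coprimep_expr; rewrite coprimep_XsubC.
  apply: contraLR => D0; apply/negP => /(dvdp_leq D0).
  rewrite prodrXl size_sqrM // ?expf_neq0 ?monic_neq0 ?monic_prod_XsubC //.
  rewrite expr2 size_monicM ?monic_prod_XsubC ?monic_neq0 ?monic_prod_XsubC //.
  rewrite size_prod_XsubC -cardT -/q.
  have := szM; rewrite -[M ^+ 2]mulr1 size_sqrM ?oner_eq0 // size_poly1.
  by move: szD; set a := size D; set b := size M; lia.
have cardq : ((q ^ 2 - 1) ^ q =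
    #|@ffun_on_mem F _ (mem [pred x : 'rV[F]_2 | x != 0%R])|)%N.
  rewrite card_ffun_on; congr (_ ^ _)%N.
  have := cardC1 (0 : 'rV[F]_2); rewrite card_mx mul1n -subn1 => <-; exact: eq_card.
rewrite cardq -cardX -(card_image psi_inj).
apply: subset_leq_card; apply/subsetP => _ /imageP[v + ->].
rewrite !inE /= -asbool_neg => /asboolP/contrapT sv; apply/andP; split.
  apply/asboolP => -[g [szg gM]]; rewrite psi1 -dvdp_mod ?dvdp_exp2r //.
  by move/sv; rewrite leqNgt szg.
apply/ffun_onP => c; rewrite !inE; apply/eqP => c0.
have := psi2 v c; rewrite c0 linear0 => /esym/modp_eq0P/sv.
by rewrite size_XsubC.
Qed.

(** * Real estimates for the weights of jets and lines *)

Section Estimates.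
Variables (R : realFieldType) (q : nat).
Hypothesis q_gt1 : (1 < q)%N.
Let Q : R := q%:R.
Let b : R := Q ^- 2.

Lemma bernoulli_ge (x : R) n : 0 <= x <= 1 -> 1 - x *+ n <= (1 - x) ^+ n.
Proof.
move=> /andP[x0 x1]; elim: n => [|n IHn]; first by rewrite mulr0n subr0.
rewrite exprSr; apply: le_trans (ler_wpM2r _ IHn); last by rewrite subr_ge0.
have : 0 <= x * x *+ n by rewrite mulrn_wge0 ?mulr_ge0.
by rewrite mulrS -mulrnAl; set y := x *+ n => h; lra.
Qed.

Let Q0 : 0 < Q. Proof. by rewrite ltr0n ltnW. Qed.
Let Qn0 : Q != 0. Proof. by rewrite gt_eqF. Qed.

Lemma invsq_itv : 0 <= b <= 1.
Proof.
rewrite invr_ge0 exprn_ge0 ?ler0n //= invf_le1 ?exprn_gt0 //.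
by rewrite -natrX ler1n expn_gt0 ltnW.
Qed.

Lemma invsq_lt1 : 0 < 1 - b.
Proof.
rewrite subr_gt0 invf_lt1 ?exprn_gt0 //.
by rewrite -natrX ltr1n -{1}(exp1n 2) ltn_exp2r.
Qed.

Lemma invsq_bernoulli : 1 - Q^-1 <= (1 - b) ^+ q.
Proof.
apply: le_trans (bernoulli_ge _ invsq_itv).
by rewrite -mulr_natr -/Q /b expr2 invfM mulfVK.
Qed.

(** The right-hand side is [Q ^+ 3 * (1 - b) ^+ q], at least [Q ^+ 3 - Q ^+ 2] by Bernoulli's
    inequality. *)
Lemma jet_None_weight n : (n + q ^ 2 <= q ^ 3)%N ->
  n%:R <= (1 - b)^-1 * Q ^+ 3 * (1 - b) ^+ q.+1.
Proof.
rewrite -(ler_nat R) natrD !natrX -/Q => h.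
have h1 : n%:R <= Q ^+ 3 * (1 - Q^-1).
  rewrite mulrBr mulr1 exprSr mulfK // -exprSr; lra.
rewrite [_ ^+ q.+1]exprS mulrACA mulVf ?gt_eqF ?invsq_lt1 // mul1r.
apply: le_trans h1 _; rewrite ler_wpM2l ?exprn_ge0 ?invsq_bernoulli //.
Qed.

(** The right-hand side simplifies to [Q * (1 - b) ^+ q.-1], at least [Q - 1] by Bernoulli's
    inequality. *)
Lemma jet_Some_weight n : (n <= q.-1)%N ->
  n%:R <= (1 - b)^-1 * Q ^+ 3 * (b * (1 - b) ^+ q).
Proof.
have b1 := invsq_lt1.
have [/ltW ltQ ltb1] := (Q0, ltW b1).
move=> h; have {h} : (n%:R : R) <= Q - 1.
  by rewrite lerBrDr natr1 ler_nat -(ltn_predK q_gt1) ltnS.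
move=> h; have qE : q = q.-1.+1 by rewrite (ltn_predK q_gt1).
have powE : (1 - b) ^+ q = (1 - b) * (1 - b) ^+ q.-1 by rewrite -exprS -qE.
have -> : (1 - b)^-1 * Q ^+ 3 * (b * (1 - b) ^+ q) = Q * (1 - b) ^+ q.-1.
  have b0 : 1 - b != 0 by rewrite gt_eqF.
  have Qb : Q ^+ 3 * b = Q by rewrite exprS /b mulfK // expf_neq0.
  have mulE (c u v d w : R) : c * u * (v * (d * w)) = c * d * (u * v) * w by ring.
  by rewrite powE mulE mulVf // mul1r Qb.
apply: le_trans h _.
have -> : Q - 1 = Q * (1 - Q^-1) by rewrite mulrBr mulr1 divff.
rewrite ler_wpM2l //; apply: le_trans invsq_bernoulli _.
rewrite powE ler_piMl ?exprn_ge0 // gerBl.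
by case/andP: invsq_itv.
Qed.

(** Dividing the count by [q ^ (k + 2 * q)] gives [1 - Q^-1 <= G / Q ^+ k * (1 - b) ^+ q]. The
    remaining factor [1 - b] belongs to the point at infinity, and the bound equals
    [1 - (1 - Q^-1) * (1 - b)]. *)
Lemma line_weight k G B :
  (q ^ (k + 2 * q) <= G * (q ^ 2 - 1) ^ q + q ^ (k + 2 * q).-1)%N ->
  (G + B = q ^ k)%N ->
  1 - (1 - B%:R / Q ^+ k) * (1 - b) ^+ q.+1 <= Q^-1 + Q ^- 2 - Q ^- 3.
Proof.
move=> h e.
have Qk0 : Q ^+ k != 0 by rewrite expf_neq0.
have -> : 1 - B%:R / Q ^+ k = G%:R / Q ^+ k.
  have QkE : Q ^+ k = G%:R + B%:R by rewrite -natrD e natrX.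
  by rewrite -[X in X - _](divff Qk0) -mulrBl {1}QkE addrK.
have bE : 1 - b = (q ^ 2 - 1)%N%:R / Q ^+ 2.
  have q2 : (0 < q ^ 2)%N by rewrite expn_gt0 (ltnW q_gt1).
  by rewrite natrB // natrX -/Q mulrBl mul1r mulfV ?expf_neq0.
have {h} h1 : 1 - Q^-1 <= G%:R / Q ^+ k * (1 - b) ^+ q.
  rewrite bE expr_div_n -exprM mulf_div -exprD.
  rewrite ler_pdivlMr ?exprn_gt0 // mulrBl mul1r.
  have : (0 < k + 2 * q)%N by lia.
  move: h; case: (k + 2 * q)%N => // m /= h _.
  rewrite [in X in _ - X]exprS mulrA mulVf // mul1r lerBlDr.
  by rewrite -!natrX -natrM -natrD ler_nat.
have -> : Q^-1 + Q ^- 2 - Q ^- 3 = 1 - (1 - Q^-1) * (1 - b) by rewrite /b; field.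
rewrite lerD2l lerN2 exprSr mulrA ler_wpM2r //.
exact/ltW/invsq_lt1.
Qed.

End Estimates.

(** * The projective plane *)

Section ProjectivePlane.
Variable F : finFieldType.
Implicit Types (u v w x : 'rV[F]_3).
Let q := #|F|.

Definition pivot v : 'I_3 := odflt ord0 [pick i | v 0 i != 0].
Definition normalize v := (v 0 (pivot v))^-1 *: v.
Definition normalized v := (v != 0) && (v 0 (pivot v) == 1).
(** Used both for points and, through coefficient vectors, for lines; each class is represented by
    its vector with pivot coordinate 1. *)
Definition proj : finType := {v : 'rV[F]_3 | normalized v}.
Definition dot u v := \sum_i u 0 i * v 0 i.

Lemma pivot_neq0 v : v != 0 -> v 0 (pivot v) != 0.
Proof.
rewrite /pivot; case: pickP => //= v0 /negP[]; apply/eqP/rowP => i.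
by have /negbFE/eqP := v0 i; rewrite mxE.
Qed.

Lemma pivotZ l v : l != 0 -> pivot (l *: v) = pivot v.
Proof.
move=> l0; congr odflt; apply: eq_pick => i.
by rewrite !mxE mulf_eq0 (negPf l0).
Qed.

Lemma normalizeZ l v : l != 0 -> normalize (l *: v) = normalize v.
Proof.
by move=> l0; rewrite /normalize pivotZ // mxE scalerA invfM mulrAC mulVf // mul1r.
Qed.

Lemma normalizedP v : v != 0 -> normalized (normalize v).
Proof.
move=> v0; have p0 := pivot_neq0 v0.
rewrite /normalized scaler_eq0 negb_or v0 invr_eq0 p0 /=.
by rewrite /normalize pivotZ ?invr_eq0 // mxE mulVf.
Qed.

Lemma normalizedE v : normalized v -> normalize v = v.
Proof. by case/andP=> _ /eqP v1; rewrite /normalize v1 invr1 scale1r. Qed.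

Lemma proj_neq0 (p : proj) : val p != 0.
Proof. by case/andP: (valP p). Qed.

Lemma proj_pivot (p : proj) : val p 0 (pivot (val p)) = 1.
Proof. by case/andP: (valP p) => _ /eqP. Qed.

Lemma projE (p p' : proj) l : val p' = l *: val p -> p' = p.
Proof.
move=> e; apply: val_inj => /=.
have l0 : l != 0.
  by apply: contraNneq (proj_neq0 p') => l0; rewrite e l0 scale0r.
by rewrite -(normalizedE (valP p')) e normalizeZ // normalizedE //; exact: valP.
Qed.

Lemma proj_of v : v != 0 -> exists l, exists2 p : proj, l != 0 & v = l *: val p.
Proof.
move=> v0; exists (v 0 (pivot v)), (exist _ (normalize v) (normalizedP v0)).
  exact: pivot_neq0.
by rewrite /= scalerA divff ?scale1r // pivot_neq0.
Qed.

Lemma card_units : #|[pred l : F | l != 0]| = q.-1.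
Proof. by rewrite -(cardC1 (0 : F)); apply: eq_card. Qed.

Lemma q_gt1 : (1 < q)%N. Proof. exact: finNzRing_gt1. Qed.

(** Every nonzero vector is in a unique way a unit times a normalized one. *)
Lemma card_proj_pred (Q : pred 'rV[F]_3) :
  (forall l v, l != 0 -> Q (l *: v) = Q v) ->
  #|[pred v | v != 0 & Q v]| = (q.-1 * #|[pred p : proj | Q (val p)]|)%N.
Proof.
move=> QZ; rewrite -card_units -cardX.
pose h (lp : F * proj) := lp.1 *: val lp.2.
rewrite -(card_in_image (f := h)); last first.
  move=> [l p] [l' p'] /andP[/= l0 _] /andP[/= l'0 _] e; rewrite /h /= in e.
  have pp' : p = p'.
    by apply: (@projE _ _ (l^-1 * l')); rewrite -scalerA -e scalerA mulVf // scale1r.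
  congr (_, _) => //; move: e; rewrite pp' => /rowP/(_ (pivot (val p'))).
  by rewrite !mxE proj_pivot !mulr1.
apply: eq_card => v; rewrite !inE; apply/andP/imageP.
  case=> v0 Qv; have [l [p l0 vE]] := proj_of v0.
  exists (l, p) => //; rewrite inE /= !inE l0 /=; by move: Qv; rewrite vE QZ.
case=> -[l p] /andP[/=]; rewrite !inE => l0 Qp ->; rewrite /h /= QZ //; split=> //.
by rewrite scaler_eq0 negb_or l0 proj_neq0.
Qed.

Lemma dotZl l u v : dot (l *: u) v = l * dot u v.
Proof. by rewrite mulr_sumr; apply: eq_bigr => i _; rewrite mxE mulrA. Qed.

Lemma dotC u v : dot u v = dot v u.
Proof. by apply: eq_bigr => i _; rewrite mulrC. Qed.

Lemma dotBl u v w : dot (u - v) w = dot u w - dot v w.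
Proof.
by rewrite -sumrB; apply: eq_bigr => i _; rewrite !mxE mulrBl.
Qed.

Lemma dot_delta v i : dot (delta_mx 0 i) v = v 0 i.
Proof.
rewrite /dot (bigD1 i) //= big1 => [|j ji]; first by rewrite mxE !eqxx mul1r addr0.
by rewrite mxE (negPf ji) andbF mul0r.
Qed.

Lemma card_perp u : u != 0 -> #|[pred v | dot v u == 0]| = (q ^ 2)%N.
Proof.
move=> u0; have k0 := pivot_neq0 u0; set k := pivot u in k0.
have dot_fib b : exists t, forall v, (dot v u == b) = (dot (v - t) u == dot 0 u).
  exists (b / u 0 k *: delta_mx 0 k) => v.
  rewrite dotBl dotZl dot_delta divfK // -(scale0r (0 : 'rV[F]_3)) dotZl mul0r.
  by rewrite subr_eq0.
have /eqP := card_preim_translate (pred1 0) dot_fib.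
rewrite card1 muln1 card_mx mul1n expnSr eqn_pmul2r; last exact: ltnW q_gt1.
by move/eqP.
Qed.

Lemma card_proj : #|proj| = (q ^ 2 + q + 1)%N.
Proof.
have := @card_proj_pred predT (fun _ _ _ => erefl).
have -> : #|[pred p : proj | predT (val p)]| = #|proj| by apply: eq_card.
have -> : #|[pred v : 'rV[F]_3 | v != 0 & predT v]| = (q ^ 3).-1%N.
  have <- : #|{: 'rV[F]_3}| = (q ^ 3)%N by rewrite card_mx mul1n.
  rewrite -(cardC1 (0 : 'rV[F]_3)).
  by apply: eq_card => v; rewrite !inE andbT.
have := q_gt1; case: q => // n n0 /eqP; rewrite /= => /eqP e.
apply/eqP; rewrite -(eqn_pmul2l n0) -e; apply/eqP; lia.
Qed.

Lemma card_proj_perp u : u != 0 -> #|[pred p : proj | dot (val p) u == 0]| = q.+1.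
Proof.
move=> u0; have := @card_proj_pred [pred v | dot v u == 0].
have -> : #|[pred v | v != 0 & [pred v | dot v u == 0] v]| = (q ^ 2).-1%N.
  rewrite -(card_perp u0) (cardD1 0 [pred v | dot v u == 0]) inE.
  rewrite -(scale0r (0 : 'rV[F]_3)) dotZl mul0r eqxx add1n.
  by apply: eq_card => v; rewrite !inE scale0r.
move=> H; have {H} : (q ^ 2).-1 = (q.-1 * #|[pred p : proj | dot (val p) u == 0%R]|)%N.
  rewrite H; first by congr (_ * _)%N; apply: eq_card.
  by move=> l v l0; rewrite /= dotZl mulf_eq0 (negPf l0).
have := q_gt1; case: q => // n n0 e.
apply/eqP; rewrite -(eqn_pmul2l n0) -e; apply/eqP; lia.
Qed.

Lemma proj_line_through (u w : proj) : u != w ->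
  exists2 a : proj, dot (val a) (val u) = 0 & dot (val a) (val w) != 0.
Proof.
move=> uw; set k := pivot (val u).
have [j wj] : exists j, val w 0 j != val w 0 k * val u 0 j.
  apply/existsP; apply: contraR uw => /existsPn wu; rewrite eq_sym; apply/eqP.
  apply: (@projE _ _ (val w 0 k)); apply/rowP => j; rewrite mxE.
  exact/eqP/negbNE/wu.
(* As [val u] has pivot coordinate 1, this line contains [u]; its value at [w] is the difference
   that [wj] makes nonzero. *)
pose a0 : 'rV[F]_3 := delta_mx 0 j - val u 0 j *: delta_mx 0 k.
have a0u : dot a0 (val u) = 0.
  by rewrite dotBl dotZl !dot_delta proj_pivot mulr1 subrr.
have a0w : dot a0 (val w) != 0.
  by rewrite dotBl dotZl !dot_delta subr_eq0 mulrC.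
have [|l [a l0 aE]] := @proj_of a0.
  by apply: contraNneq a0w => ->; rewrite -(scale0r (0 : 'rV[F]_3)) dotZl mul0r.
exists a; first by move/eqP: a0u; rewrite aE dotZl mulf_eq0 (negPf l0) => /eqP.
by move: a0w; rewrite aE dotZl mulf_eq0 negb_or l0.
Qed.

Lemma proj_other_line (u b : proj) :
  exists2 a : proj, a != b & dot (val a) (val u) = 0.
Proof.
have := card_proj_perp (proj_neq0 u); rewrite (cardD1 b) => e.
have : (0 < #|[predD1 [pred p : proj | dot (val p) (val u) == 0%R] & b]|)%N.
  rewrite lt0n; apply: contra_eqN e => /eqP ->; rewrite addn0.
  by have := q_gt1; case: q => [|[]] // n _; case: (_ \in _).
by case/card_gt0P => a; rewrite !inE => /andP[ab /eqP au]; exists a.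
Qed.

(* A form [f] is recorded at the point [u] by its jet: the value [f u] in place
   of the pivot coordinate of the gradient, which is redundant by Euler's
   relation.  When [f u = 0], the gradient is recovered from the jet as the
   vector orthogonal to [u] below. *)
Definition jet_grad u x := x - dot x u *: delta_mx 0 (pivot u).

(** The answer is [None] when the form does not vanish at [u], and also when the gradient is zero,
    since [normalize 0] is not normalized. *)
Definition jet_line u x : option proj :=
  if x 0 (pivot u) == 0 then insub (normalize (jet_grad u x)) else None.

Lemma jet_lineE (u a : proj) x l : l != 0 -> dot (val a) (val u) = 0 ->
  x 0 (pivot (val u)) = 0 ->
  (forall i, i != pivot (val u) -> x 0 i = l * val a 0 i) ->
  jet_line (val u) x = Some a.
Proof.
set k := pivot (val u) => l0 au xk xi.
have xu : dot x (val u) = - (l * val a 0 k).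
  have : dot (l *: val a - x) (val u) = l * val a 0 k.
    rewrite /dot (bigD1 k) //= big1 => [|i ik]; last by rewrite !mxE xi // subrr mul0r.
    by rewrite !mxE xk proj_pivot subr0 mulr1 addr0.
  by rewrite dotBl dotZl au mulr0 sub0r => <-; rewrite opprK.
have gE : jet_grad (val u) x = l *: val a.
  apply/rowP => i; rewrite !mxE xu eqxx /= -/k.
  have [->|ik] := eqVneq i k; first by rewrite xk mulr1 sub0r opprK.
  by rewrite xi // mulr0 subr0.
rewrite /jet_line xk eqxx gE normalizeZ // normalizedE; last exact: valP.
exact: valK.
Qed.

(** A nonzero jet with pivot coordinate 0 has a nonzero gradient and so a tangent line; that removes
    a plane of [q ^ 2] jets. *)
Lemma card_jet_line_None (u : proj) :
  (#|[pred x | x != 0%R & jet_line (val u) x == None]| + q ^ 2 <= q ^ 3)%N.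
Proof.
set k := pivot (val u).
have d0 : delta_mx 0 k != 0 :> 'rV[F]_3.
  apply/eqP => /rowP/(_ k)/eqP; rewrite !mxE !eqxx; exact/negP/oner_neq0.
rewrite -(card_perp d0).
have <- : #|{: 'rV[F]_3}| = (q ^ 3)%N by rewrite card_mx mul1n.
rewrite -(cardC [pred v | dot v (delta_mx 0 k) == 0]) addnC leq_add2l.
apply: subset_leq_card; apply/subsetP => x; rewrite !inE => /andP[x0].
apply: contraTN; rewrite dotC dot_delta => /eqP xk.
rewrite /jet_line xk eqxx; case: insubP => //= /negP[]; apply: normalizedP.
apply: contraNneq x0 => /rowP g0; apply/eqP/rowP => i.
have [->|ik] := eqVneq i k; first by rewrite xk mxE.
by have := g0 i; rewrite !mxE (negPf ik) andbF mulr0 subr0.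
Qed.

Lemma jet_line_SomeP (u a : proj) x : jet_line (val u) x = Some a ->
  [/\ dot (val a) (val u) = 0, x 0 (pivot (val u)) = 0 & exists2 l, l != 0 &
    forall i, i != pivot (val u) -> x 0 i = l * val a 0 i].
Proof.
set k := pivot (val u); rewrite /jet_line; case: eqP => // xk.
case: insubP => // a' ng aE [aa]; subst a'.
set g := jet_grad (val u) x in ng aE.
have g0 : g != 0.
  by apply: contraTneq ng => ->; rewrite /normalize scaler0 /normalized eqxx.
have p0 := pivot_neq0 g0.
have gE : g = g 0 (pivot g) *: val a.
  by rewrite aE /normalize scalerA divff // scale1r.
split=> //.
  apply/eqP; rewrite -(mulrI_eq0 _ (mulfI p0)) -dotZl -gE.
  by rewrite dotBl dotZl dot_delta proj_pivot mulr1 subrr.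
exists (g 0 (pivot g)) => // i ik.
have := congr1 (fun v : 'rV_3 => v 0 i) gE.
by rewrite /= !mxE (negPf ik) andbF mulr0 subr0.
Qed.

(** Such a jet is determined by the unit [l] relating its gradient to [val a]. *)
Lemma card_jet_line_Some (u a : proj) :
  (#|[pred x | x != 0%R & jet_line (val u) x == Some a]| <=
    if dot (val a) (val u) == 0%R then q.-1 else 0)%N.
Proof.
case: ifPn => [_|au]; last first.
  rewrite leqn0; apply/eqP/eq_card0 => x; rewrite !inE; apply/negP => /andP[_ /eqP].
  by case/jet_line_SomeP => /eqP; rewrite (negPf au).
set k := pivot (val u).
pose h l : 'rV[F]_3 := l *: (val a - val a 0 k *: delta_mx 0 k).
rewrite -card_units; apply: leq_trans (leq_image_card h _).
apply: subset_leq_card; apply/subsetP => x; rewrite !inE => /andP[_ /eqP].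
case/jet_line_SomeP => _ xk [l l0 xi]; apply/imageP; exists l => //.
apply/rowP => i; rewrite !mxE eqxx /=.
have [->|ik] := eqVneq i k; first by rewrite xk mulr1 subrr mulr0.
by rewrite xi // mulr0 subr0.
Qed.

End ProjectivePlane.

(** * Forms, jets and restrictions to lines *)

Section Mmap.
Variables (n : nat) (A : comNzRingType).
Implicit Type p : {mpoly A[n]}.

Lemma rmorph_mmap (B C : comNzRingType) (f : A -> B) (g : {rmorphism B -> C})
    (f' : A -> C) (h : 'I_n -> B) (h' : 'I_n -> C) p :
  (forall a, g (f a) = f' a) -> (forall i, g (h i) = h' i) ->
  g (mmap f h p) = mmap f' h' p.
Proof.
move=> gf gh; rewrite /mmap rmorph_sum; apply: eq_bigr => m _.
rewrite rmorphM gf rmorph_prod; congr (_ * _).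
by apply: eq_bigr => i _; rewrite rmorphXn /= gh.
Qed.

Lemma eq_mmap (B : comNzRingType) (f : A -> B) (h h' : 'I_n -> B) p :
  h =1 h' -> mmap f h p = mmap f h' p.
Proof.
by move=> hh; rewrite /mmap; apply: eq_bigr => m _; rewrite (mmap1_eq _ hh).
Qed.

Lemma mmap_homogZ (B : comNzRingType) (f : A -> B) (h : 'I_n -> B) d c p :
  p \is d.-homog -> mmap f (fun i => c * h i) p = c ^+ d * mmap f h p.
Proof.
move=> /dhomogP pd; rewrite /mmap mulr_sumr; apply: eq_big_seq => m /pd /= <-.
rewrite mulrCA; congr (_ * _); rewrite /mmap1 mdegE.
rewrite -prodrXr -big_split /=; apply: eq_bigr => i _; exact: exprMn.
Qed.

Lemma mderiv_homog d i p : p \is d.-homog -> p^`M(i) \is d.-1.-homog.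
Proof.
move=> /dhomogP pd; apply/dhomogP => m; rewrite mcoeff_msupp mcoeff_mderiv => pm.
have : (m + U_(i))%MM \in msupp p.
  by rewrite mcoeff_msupp; apply: contraNneq pm => ->; rewrite mul0rn.
by move/pd => /= <-; rewrite mdegD mdeg1 addn1.
Qed.

(** Chain rule: it holds for constants and variables, and passes to products by Leibniz and to
    sums. *)
Lemma deriv_mmap (h : 'I_n -> {poly A}) p :
  (mmap polyC h p)^`() = \sum_i mmap polyC h p^`M(i) * (h i)^`().
Proof.
pose P q := (mmap polyC h q)^`() = \sum_i mmap polyC h q^`M(i) * (h i)^`().
have PM q1 q2 : P q1 -> P q2 -> P (q1 * q2).
  rewrite /P => e1 e2; rewrite rmorphM derivM e1 e2 mulr_suml mulr_sumr -big_split /=.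
  by apply: eq_bigr => i _; rewrite mderivM raddfD /= !rmorphM /=; ring.
have PC c : P c%:MP.
  rewrite /P mmapC derivC big1 // => i _.
  by rewrite mderivC raddf0 mul0r.
have PX i : P 'X_i.
  rewrite /P mmapX mmap1U (bigD1 i) //= big1 => [|j ji].
    rewrite mderivX mnm1E eqxx scale1r (_ : (U_(i) - U_(i) = 0)%MM).
      by rewrite mpolyX0 rmorph1 mul1r addr0.
    by apply/mnmP => j; rewrite mnmBE subnn mnm0E.
  by rewrite mderivX mnm1E eq_sym (negPf ji) scale0r raddf0 mul0r.
suff: forall q, P q by apply.
apply: (@mpolyind n A P) => [|c m q _ _ IH]; first by rewrite -(mpolyC0 n); exact: PC.
rewrite /P raddfD /= derivD IH.
have -> : (mmap polyC h (c *: 'X_[m]))^`() =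
    \sum_i mmap polyC h (c *: 'X_[m])^`M(i) * (h i)^`().
  suff: P (c *: 'X_[m]) by [].
  rewrite -mul_mpolyC; apply: (PM _ _ (PC c)).
  rewrite mpolyXE_id /mmap1; elim/big_ind: _ => [|x y|i _]; [exact: PC|exact: PM|].
  elim: (m i) => [|k IHk]; first exact: PC.
  by rewrite exprS; apply: PM.
by rewrite -big_split /=; apply: eq_bigr => i _; rewrite mderivD raddfD /= mulrDl.
Qed.

(** Obtained by differentiating [p('X * u) = 'X^d * p(u)] and evaluating at 1, which works in every
    characteristic. *)
Lemma euler_homog d (u : 'I_n -> A) p : p \is d.-homog ->
  \sum_i p^`M(i).@[u] * u i = p.@[u] *+ d.
Proof.
move=> pd; have mevalP (q : {mpoly A[n]}) :
    (mmap polyC (fun i => 'X * (u i)%:P) q).[1] = q.@[u].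
  have -> : (mmap polyC (fun i => 'X * (u i)%:P) q).[1] =
      horner_eval 1 (mmap polyC (fun i => 'X * (u i)%:P) q) by [].
  apply: rmorph_mmap => [a|i]; rewrite /= /horner_eval ?hornerC //.
  by rewrite hornerM hornerX hornerC mul1r.
have := congr1 (horner^~ 1) (deriv_mmap (fun i => 'X * (u i)%:P) p).
rewrite (mmap_homogZ _ _ _ pd) horner_sum => /esym e.
transitivity (('X^d * mmap polyC (fun i => (u i)%:P) p)^`().[1]).
  rewrite -e; apply: eq_bigr => i _; rewrite hornerM mevalP.
  by rewrite derivM derivX derivC mulr0 addr0 mul1r hornerC.
have -> : mmap polyC (fun i => (u i)%:P) p = (p.@[u])%:P.
  by apply/esym/rmorph_mmap.
rewrite derivM derivC mulr0 addr0 derivXn hornerM hornerMn hornerC.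
by rewrite hornerXn expr1n mulrnAl mul1r.
Qed.

End Mmap.

(** * Jets at points and restrictions to lines of ternary forms *)

Section JetsAndRestrictions.
Variable F : finFieldType.
Implicit Types (u x : 'rV[F]_3) (f g : {mpoly F[3]}) (a b : proj F).

Definition linform u : {mpoly F[3]} := \sum_i u 0 i *: 'X_i.

Lemma meval_linform u x : (linform u).@[x 0] = dot u x.
Proof. by rewrite raddf_sum; apply: eq_bigr => i _; rewrite /= mevalZ mevalXU. Qed.

Lemma linform_homog u : linform u \is 1.-homog.
Proof.
by apply: rpred_sum => i _; apply: rpredZ; rewrite dhomogX /= mdeg1.
Qed.

Definition jet u f : 'rV[F]_3 :=
  \row_i (if i == pivot u then f.@[u 0] else f^`M(i).@[u 0]).

Lemma jetD u f g : jet u (f + g) = jet u f + jet u g.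
Proof. by apply/rowP => i; rewrite !mxE mderivD !mevalD; case: ifP. Qed.

Lemma jet0 u : jet u 0 = 0.
Proof. by apply/rowP => i; rewrite !mxE mderiv0 !meval0 if_same. Qed.

Lemma jetB u f g : jet u (f - g) = jet u f - jet u g.
Proof. by apply/rowP => i; rewrite !mxE mderivB !mevalB; case: ifP. Qed.

Lemma jet_sum (I : finType) u (G : I -> {mpoly F[3]}) :
  jet u (\sum_i G i) = \sum_i jet u (G i).
Proof. exact: (big_morph _ (jetD u) (jet0 u)). Qed.

Lemma jet_sqr u f g : f.@[u 0] = 0 -> jet u (f ^+ 2 * g) = 0.
Proof.
move=> f0; apply/rowP => i; rewrite !mxE expr2 !mderivM.
by rewrite !(mevalM, mevalD) f0; case: ifP => _; ring.
Qed.

(** Near [u] the coordinate ['X_k] plays the role of 1, so a linear form realises any jet of [h];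
    Leibniz's rule for [g * h] can be solved for it because [g] is invertible at [u]. *)
Lemma jet_surj (u : proj F) g x d : g.@[val u 0] != 0 ->
  exists2 h, h \is d.+1.-homog & jet (val u) (g * h) = x.
Proof.
set k := pivot (val u) => g0; set e := (g.@[val u 0])^-1.
(* [c] is the required value of [h] at [u], and [y i] its required derivatives. *)
pose c := x 0 k * e.
pose y i := (x 0 i - g^`M(i).@[val u 0] * c) * e.
pose lin := c *: 'X_k + \sum_(i < 3 | i != k) y i *: ('X_i - val u 0 i *: 'X_k)
  : {mpoly F[3]}.
have uk : val u 0 k = 1 by exact: proj_pivot.
have X1 i : ('X_i : {mpoly F[3]}) \is 1.-homog by rewrite dhomogX /= mdeg1.
have lin1 : lin \is 1.-homog.
  apply: rpredD; first by apply: rpredZ.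
  by apply: rpred_sum => i _; apply: rpredZ; apply: rpredB => //; apply: rpredZ.
have linv : lin.@[val u 0] = c.
  rewrite mevalD mevalZ mevalXU uk mulr1 raddf_sum big1 /= ?addr0 // => i _.
  by rewrite mevalZ mevalB mevalZ !mevalXU uk mulr1 subrr mulr0.
have mdX (i j : 'I_3) : ('X_j : {mpoly F[3]})^`M(i).@[val u 0] = (j == i)%:R.
  rewrite mderivX mevalZ mnm1E; case: eqVneq => [->|_]; last by rewrite mul0r.
  rewrite mul1r (_ : (U_(i) - U_(i) = 0)%MM) ?mpolyX0 ?meval1 //.
  by apply/mnmP => l; rewrite mnmBE subnn mnm0E.
have lind i : i != k -> lin^`M(i).@[val u 0] = y i.
  move=> ik; rewrite mderivD mevalD mderivZ mevalZ mdX eq_sym (negPf ik).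
  rewrite mulr0 add0r (raddf_sum (mderiv i)) (raddf_sum (meval _)) /=.
  rewrite (bigD1 i) //= big1 ?addr0.
    rewrite mderivZ mderivB mderivZ mevalZ mevalB mevalZ !mdX eqxx eq_sym (negPf ik).
    by rewrite mulr0 subr0 mulr1.
  move=> j /andP[jk ji].
  rewrite mderivZ mderivB mderivZ mevalZ mevalB mevalZ !mdX (negPf ji) eq_sym (negPf ik).
  by rewrite mulr0 subr0 mulr0.
exists ('X_k ^+ d * lin).
  have := dhomogM (dhomogMn d (X1 k)) lin1.
  by rewrite mul1n addn1.
have hv : ('X_k ^+ d * lin).@[val u 0] = c.
  by rewrite mevalM linv rmorphXn /= mevalXU uk expr1n mul1r.
have hd i : i != k -> ('X_k ^+ d * lin)^`M(i).@[val u 0] = y i.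
  move=> ik; rewrite mderivM mevalD !mevalM lind // linv.
  rewrite [('X_k ^+ d).@[_]]rmorphXn /= mevalXU uk expr1n mul1r.
  rewrite (_ : ('X_k ^+ d)^`M(i) = 0) ?meval0 ?mul0r ?add0r //.
  elim: (d) => [|n IHn]; first by rewrite expr0 -mpolyC1 mderivC.
  rewrite exprS mderivM IHn mulr0 addr0 mderivX mnm1E eq_sym (negPf ik).
  by rewrite scale0r mul0r.
apply/rowP => i; rewrite mxE -/k; case: eqVneq => [->|ik].
  by rewrite mevalM hv /c mulrCA mulfV // mulr1.
rewrite mderivM mevalD (mevalM _ g^`M(i)) (mevalM _ g) hv hd // /y.
have solve (D c' G e' X : F) : e' * G = 1 -> D * c' + G * ((X - D * c') * e') = X.
  by move=> eG; transitivity (D * c' + (X - D * c') * (e' * G)); [|rewrite eG]; ring.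
by apply: solve; rewrite mulVf.
Qed.

Definition idx1 u : 'I_3 := lift (pivot u) (0 : 'I_2).
Definition idx2 u : 'I_3 := lift (pivot u) (1 : 'I_2).

Lemma sum_idx (V : nmodType) u (G : 'I_3 -> V) :
  \sum_i G i = G (pivot u) + (G (idx1 u) + G (idx2 u)).
Proof.
rewrite (bigD1_ord (pivot u)) //= big_ord_recl big_ord1; congr (_ + (G _ + G _)).
by congr lift; apply: val_inj.
Qed.

Lemma idx_case u (P : 'I_3 -> Prop) :
  P (pivot u) -> P (idx1 u) -> P (idx2 u) -> forall i, P i.
Proof.
move=> P0 P1 P2 i; case: (unliftP (pivot u) i) => [j ->|-> //].
have [e|e] : j = 0 \/ j = 1; last by rewrite e.
  by case: j => -[|[|]] // p; [left|right]; apply: val_inj.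
by rewrite e.
Qed.

Lemma idx_neq u : [/\ idx1 u != pivot u, idx2 u != pivot u & idx1 u != idx2 u].
Proof.
rewrite /idx1 /idx2 ![_ == pivot u]eq_sym !neq_lift; split=> //.
by rewrite (inj_eq lift_inj).
Qed.

(* The line [a] is parametrised by [t |-> line_pt1 a + t *: line_pt2 a]. *)
Definition line_pt1 u : 'rV[F]_3 :=
  delta_mx 0 (idx1 u) - u 0 (idx1 u) *: delta_mx 0 (pivot u).
Definition line_pt2 u : 'rV[F]_3 :=
  delta_mx 0 (idx2 u) - u 0 (idx2 u) *: delta_mx 0 (pivot u).

Lemma line_ptE u :
  [/\ line_pt1 u 0 (idx1 u) = 1, line_pt1 u 0 (idx2 u) = 0,
      line_pt1 u 0 (pivot u) = - u 0 (idx1 u) &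
   [/\ line_pt2 u 0 (idx1 u) = 0, line_pt2 u 0 (idx2 u) = 1 &
       line_pt2 u 0 (pivot u) = - u 0 (idx2 u)]].
Proof.
have [/negPf n1 /negPf n2 /negPf n12] := idx_neq u.
rewrite !mxE !eqxx n1 n2 n12 ![pivot u == _]eq_sym n1 n2 eq_sym n12 /=.
by split; [..|split]; rewrite ?mulr0 ?mulr1 ?subr0 ?sub0r.
Qed.

Lemma dot_line_pt1 b u : dot (val b) (line_pt1 u) =
  val b 0 (idx1 u) - u 0 (idx1 u) * val b 0 (pivot u).
Proof. by rewrite dotC dotBl dotZl !dot_delta. Qed.

Lemma dot_line_pt2 b u : dot (val b) (line_pt2 u) =
  val b 0 (idx2 u) - u 0 (idx2 u) * val b 0 (pivot u).
Proof. by rewrite dotC dotBl dotZl !dot_delta. Qed.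

(** The affine parameter misses one point of the line, [line_pt2 u]. *)
Definition restr u f : {poly F} :=
  mmap polyC (fun i => (line_pt1 u 0 i)%:P + line_pt2 u 0 i *: 'X) f.

Lemma restrB u f g : restr u (f - g) = restr u f - restr u g.
Proof. exact: raddfB. Qed.

Lemma restrM u f g : restr u (f * g) = restr u f * restr u g.
Proof. exact: rmorphM. Qed.

Lemma restrX u i : restr u 'X_i = (line_pt1 u 0 i)%:P + line_pt2 u 0 i *: 'X.
Proof. by rewrite /restr mmapX mmap1U. Qed.

Lemma restrZ u c f : restr u (c *: f) = c *: restr u f.
Proof. by rewrite /restr mmapZ mul_polyC. Qed.

Lemma restr_linform u x :
  restr u (linform x) = (dot x (line_pt1 u))%:P + dot x (line_pt2 u) *: 'X.
Proof.
rewrite /restr raddf_sum /= (eq_bigr (fun i => (x 0 i * line_pt1 u 0 i)%:P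
   + (x 0 i * line_pt2 u 0 i) *: 'X)) => [|i _].
  by rewrite big_split /= -scaler_suml -rmorph_sum.
by rewrite -/(restr u _) restrZ restrX scalerDr scalerA -mul_polyC -polyCM.
Qed.

Lemma restr_linform_self a : restr (val a) (linform (val a)) = 0.
Proof.
by rewrite restr_linform dot_line_pt1 dot_line_pt2 proj_pivot !mulr1 !subrr scale0r addr0.
Qed.

Lemma restr_linform_neq0 a b : b != a -> restr (val a) (linform (val b)) != 0.
Proof.
rewrite restr_linform => ba; apply/eqP => /polyP e.
have := e 0%N; rewrite coefD coefC coefZ coefX coef0 /= mulr0 addr0.
have := e 1%N; rewrite coefD coefC coefZ coefX coef0 /= mulr1 add0r.
rewrite dot_line_pt1 dot_line_pt2 => /subr0_eq e2 /subr0_eq e1.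
case/eqP: ba; apply: (@projE _ _ _ (val b 0 (pivot (val a)))); apply/rowP.
apply: (idx_case (u := val a)); rewrite mxE ?proj_pivot ?mulr1 //.
  by rewrite e1 mulrC.
by rewrite e2 mulrC.
Qed.

(** The coordinates [idx1 u] and [idx2 u] restrict to 1 and ['X], so homogenising [p] in these two
    variables is enough. *)
Lemma restr_surj u (p : {poly F}) d : (size p <= d.+1)%N ->
  exists2 h, h \is d.-homog & restr u h = p.
Proof.
move=> szp; have [l1 l2 l3 [l4 l5 l6]] := line_ptE u.
have Ri : restr u 'X_(idx1 u) = 1 by rewrite restrX l1 l4 scale0r addr0.
have Rj : restr u 'X_(idx2 u) = 'X by rewrite restrX l2 l5 scale1r add0r.
exists (\sum_(i < d.+1) p`_i *: ('X_(idx1 u) ^+ (d - i) * 'X_(idx2 u) ^+ i)).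
  apply: rpred_sum => i _; apply: rpredZ.
  have X1 j : ('X_j : {mpoly F[3]}) \is 1.-homog by rewrite dhomogX /= mdeg1.
  have := dhomogM (dhomogMn (d - i) (X1 (idx1 u))) (dhomogMn i (X1 (idx2 u))).
  by rewrite !mul1n subnK // -ltnS.
rewrite /restr raddf_sum /= -/(restr u); transitivity (\sum_(i < d.+1) p`_i *: 'X^i).
  apply: eq_bigr => i _; rewrite -/(restr u _) restrZ restrM.
  by rewrite /restr !rmorphXn /= -!/(restr u _) Ri Rj expr1n mul1r.
rewrite -poly_def; apply/polyP => i; rewrite coef_poly; case: ltnP => // di.
by rewrite nth_default // (leq_trans szp).
Qed.

End JetsAndRestrictions.

(** * Interpolation *)

(** A non-constant common divisor would be linear and give a root of [M]. *)
Lemma coprimep_rootless (K : fieldType) (p M : {poly K}) :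
  p != 0 -> (size p <= 2)%N -> (forall c, ~~ root M c) -> coprimep p M.
Proof.
move=> p0 szp rM; rewrite /coprimep; set d := gcdp p M.
have [dp dM] : d %| p /\ d %| M by rewrite dvdp_gcdl dvdp_gcdr.
have d0 : d != 0 by rewrite gcdp_eq0 (negPf p0).
have szd : (size d <= 2)%N := leq_trans (dvdp_leq p0 dp) szp.
have : (0 < size d)%N by rewrite size_poly_gt0.
move: szd; rewrite leq_eqVlt => /predU1P[/poly2_root[r dr]|]; last first.
  by case: (size d) => [|[]].
by case/negP: (rM r); rewrite -dvdp_XsubCl (dvdp_trans _ dM) // dvdp_XsubCl.
Qed.

Section Interpolation.
Variable F : finFieldType.
Implicit Types (u a b : proj F).

(** The squares make value and gradient vanish at every point of the chosen lines. *)
Definition sqprod (P : pred (proj F)) : {mpoly F[3]} :=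
  \prod_(b | P b) linform (val b) ^+ 2.

Lemma sqprod_homog P : exists2 e, (e <= 2 * #|proj F|)%N & sqprod P \is e.-homog.
Proof.
suff [e es eP] : exists2 e, (e <= \sum_(b | P b) 2)%N & sqprod P \is e.-homog.
  by exists e; rewrite // (leq_trans es) // sum_nat_const mulnC leq_mul2l max_card.
rewrite /sqprod; elim/big_rec2: _ => [|b n p _ [e en pe]].
  by exists 0%N; rewrite // dhomog1.
exists (1 * 2 + e)%N; first lia.
exact/dhomogM/pe/dhomogMn/linform_homog.
Qed.

Lemma jet_sqprod (P : pred (proj F)) u b g : P b -> dot (val b) (val u) = 0 ->
  jet (val u) (sqprod P * g) = 0.
Proof.
move=> Pb bu; rewrite /sqprod (bigD1 b) //= -mulrA jet_sqr //.
by rewrite meval_linform.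
Qed.

Variables (M : {poly F}) (k : nat).
Hypotheses (M_rootless : forall c, ~~ root M c) (size_M : size (M ^+ 2) = k.+1).

Lemma restr_sqprod_coprime a : coprimep (restr (val a) (sqprod (predC1 a))) (M ^+ 2).
Proof.
apply: coprimep_expr; rewrite /restr rmorph_prod /=.
elim/big_ind: _ => [|p q cp cq|b ba]; first exact: coprime1p.
  by rewrite coprimepMl cp.
rewrite rmorphXn /=; apply/coprimep_expl/coprimep_rootless => //.
  exact: restr_linform_neq0.
rewrite -/(restr _ _) restr_linform (leq_trans (size_polyD _ _)) // geq_max.
by rewrite (leq_trans (size_polyC_leq1 _)) //
  (leq_trans (size_scale_leq _ _)) // size_polyX.
Qed.

(** Jets are prescribed first, one point at a time. The restrictions are then corrected one line at
    a time by forms with zero jet at every F-point. *)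
Lemma interpolation d (x : proj F -> 'rV[F]_3) (m : proj F -> {poly F}) :
  (2 * #|proj F| + k < d)%N -> (forall a, (size (m a) <= k)%N) ->
  exists f, [/\ f \is d.-homog, forall u, jet (val u) f = x u &
    forall a, restr (val a) f %% M ^+ 2 = m a].
Proof.
move=> dk szm.
have M0 : M ^+ 2 != 0 by rewrite -size_poly_gt0 size_M.
(* A multiple of the squares of all lines missing [u]: every other F-point lies on such a line. *)
have jetP u : exists f, [/\ f \is d.-homog, jet (val u) f = x u &
    forall u', u' != u -> jet (val u') f = 0].
  pose P := [pred b : proj F | dot (val b) (val u) != 0].
  have [e ele eP] := sqprod_homog P.
  have Pu : (sqprod P).@[val u 0] != 0.
    rewrite rmorph_prod; apply/prodf_neq0 => b /= bu.
    by rewrite rmorphXn /= meval_linform expf_neq0.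
  have [h hd hx] := jet_surj (x u) (d - e).-1 Pu.
  exists (sqprod P * h); split=> [|//|u' u'u].
    have := dhomogM eP hd; rewrite prednK ?subn_gt0; last lia.
    by rewrite subnKC //; lia.
  by have [b bu' bu] := proj_line_through u'u; apply: (jet_sqprod (b := b)).
pose jetf u := projT1 (cid (jetP u)).
have jetfP u : [/\ jetf u \is d.-homog, jet (val u) (jetf u) = x u &
    forall u', u' != u -> jet (val u') (jetf u) = 0] by exact: (projT2 (cid (jetP u))).
pose f1 := \sum_u jetf u.
have f1d : f1 \is d.-homog by apply: rpred_sum => u _; case: (jetfP u).
have f1j u : jet (val u) f1 = x u.
  rewrite /f1 jet_sum (bigD1 u) //= big1 ?addr0; first by case: (jetfP u).
  by move=> u' u'u; case: (jetfP u') => _ _; apply; rewrite eq_sym.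
(* A multiple of the squares of all lines other than [a]: it vanishes on these lines, and every
   F-point lies on one of them. *)
have restrP a : exists f, [/\ f \is d.-homog, forall u, jet (val u) f = 0,
    restr (val a) f %% M ^+ 2 = m a - restr (val a) f1 %% M ^+ 2 &
    forall a', a' != a -> restr (val a') f = 0].
  set g := restr (val a) (sqprod (predC1 a)).
  set y := m a - _.
  have szy : (size y < size (M ^+ 2))%N.
    rewrite size_M ltnS (leq_trans (size_polyD _ _)) // geq_max szm size_polyN.
    by rewrite -ltnS -size_M ltn_modp.
  (* [v] inverts [g] modulo [M ^+ 2], so a cofactor restricting to [y * v] produces the residue
     [y]. *)
  have [[v w] /= vw] := Bezout_eq1_coprimepP _ _ (restr_sqprod_coprime a).
  have [e ele eP] := sqprod_homog (predC1 a).
  have [|h hd hr] := @restr_surj F (val a) ((y * v) %% M ^+ 2) (d - e).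
    have := ltn_modp (y * v) (M ^+ 2); rewrite M0 size_M.
    by set s := size _; lia.
  exists (sqprod (predC1 a) * h); split.
  - by have := dhomogM eP hd; rewrite subnKC //; lia.
  - by move=> u; have [b ba bu] := proj_other_line u a; apply: (jet_sqprod (b := b)).
  - rewrite restrM hr modp_mul -/g.
    have -> : g * (y * v) = y - (y * w) * M ^+ 2.
      transitivity (y * (v * g + w * M ^+ 2) - y * w * M ^+ 2); first by ring.
      by rewrite vw mulr1.
    by rewrite modpD modpN modp_mull subr0 modp_small.
  - move=> a' a'a; rewrite restrM /sqprod (bigD1 a') //= expr2 !restrM.
    by rewrite restr_linform_self !mul0r.
pose resf a := projT1 (cid (restrP a)).
have resfP a : [/\ resf a \is d.-homog, forall u, jet (val u) (resf a) = 0,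
    restr (val a) (resf a) %% M ^+ 2 = m a - restr (val a) f1 %% M ^+ 2 &
    forall a', a' != a -> restr (val a') (resf a) = 0].
  exact: (projT2 (cid (restrP a))).
exists (f1 + \sum_a resf a); split.
- by apply: rpredD => //; apply: rpred_sum => a _; case: (resfP a).
- move=> u; rewrite jetD f1j jet_sum big1 ?addr0 // => a _.
  by case: (resfP a) => _ ->.
- move=> a; have restrD f g : restr (val a) (f + g) = restr (val a) f + restr (val a) g.
    exact: raddfD.
  rewrite restrD {2}/restr raddf_sum /= (bigD1 a) //= big1 ?addr0.
    by rewrite -/(restr _ _) modpD; case: (resfP a) => _ _ -> _; rewrite addrC subrK.
  by move=> a' a'a; case: (resfP a') => _ _ _; apply; rewrite eq_sym.
Qed.

End Interpolation.

(** * Tangency *)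

Section Tangency.
Variables (F : finFieldType) (L : fieldExtType F).
Implicit Types (f : {mpoly F[3]}) (u : 'rV[F]_3) (a : proj F) (v : 'I_3 -> L).
Local Notation iota := (in_alg L).

Lemma evalLE f v : evalL f v = mmap iota v f.
Proof.
rewrite /evalL; apply: (rmorph_mmap (g := meval v)) => [c|i] /=.
  exact: mevalC.
by rewrite mevalXU.
Qed.

Lemma evalL_homogZ f v c d : f \is d.-homog ->
  evalL f (fun i => c * v i) = c ^+ d * evalL f v.
Proof. by move=> fd; rewrite !evalLE; apply: mmap_homogZ. Qed.

Lemma eq_evalL f v v' : v =1 v' -> evalL f v = evalL f v'.
Proof. by move=> vv'; rewrite !evalLE; apply: eq_mmap. Qed.

Lemma evalL_iota f u : evalL f (fun i => iota (u 0 i)) = iota f.@[u 0].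
Proof. by rewrite evalLE; apply/esym/rmorph_mmap. Qed.

(** The minimal polynomial divides ['X^#|L| - 'X], a product of distinct linear factors. *)
Lemma simple_root_minPoly (t : L) : (minPoly 1 t)^`().[t] != 0.
Proof.
pose T := finvect_type L.
have rootX : minPoly 1 t %| \prod_(x : T) ('X - (x : L)%:P).
  have -> : \prod_(x : T) ('X - (x : L)%:P) = 'X^#|{: T}| - 'X :> {poly L}.
    exact/esym/(finField_genPoly T).
  apply: minPoly_dvdp; first by rewrite rpredB ?polyOverXn ?polyOverX.
  rewrite rootE !hornerE subr_eq0; apply/eqP; exact: (expf_card (t : T)).
apply/eqP => d0.
have : root (minPoly 1 t) t by apply: root_minPoly.
rewrite -dvdp_XsubCl => /dvdpP[g mE].
have : root g t.
  by move: d0; rewrite mE derivM derivXsubC mulr1 !hornerE subrr mulr0 add0r => /eqP.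
rewrite -dvdp_XsubCl => /dvdpP[h gE].
move: rootX; rewrite (bigD1 (t : T)) //= mE gE mulrC.
rewrite dvdp_mul2l ?polyXsubC_eq0 // => /(dvdp_trans (dvdp_mulIr h _)).
rewrite dvdp_XsubCl /root horner_prod => /prodf_eq0[x /= xt].
by rewrite hornerXsubC subr_eq0 eq_sym; apply/negP.
Qed.

(** With [p = h * g], the derivative at [t] is [h(t) * g'(t)]; as [t] is a simple root of [g], it is
    a root of [h], and [g] divides [h] too. *)
Lemma minPoly_sqr_dvd (t : L) (p : {poly F}) :
  (map_poly iota p).[t] = 0 -> (map_poly iota p^`()).[t] = 0 -> t \notin 1%VS ->
  exists g : {poly F}, [/\ size g = (adjoin_degree 1 t).+1, (1 < size g)%N,
    (forall c, ~~ root g c) & g ^+ 2 %| p].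
Proof.
move=> pt dpt t1.
have [g gE] := polyOver1P (minPolyOver 1 t).
have szg : size g = (adjoin_degree 1 t).+1.
  by rewrite -(size_map_poly iota) -gE size_minPoly.
have gdvd (h : {poly F}) : (map_poly iota h).[t] = 0 -> g %| h.
  move=> ht; rewrite -(dvdp_map iota) -gE; apply: minPoly_dvdp; last exact/eqP.
  by apply/polyOver1P; exists h.
have g0 : g != 0 by rewrite -size_poly_gt0 szg.
have gt : (map_poly iota g).[t] = 0 by rewrite -gE; apply/eqP/root_minPoly.
exists g; split=> //.
- rewrite szg ltnS lt0n; apply: contraNneq t1 => deg0.
  have := root_minPoly 1 t; rewrite /root; have := size_minPoly 1 t.
  rewrite deg0 => /eqP/size_poly1P[c c0 ->]; rewrite hornerC => /eqP c0'.
  by rewrite c0' eqxx in c0.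
(* Were [c] a root, the cofactor of ['X - c%:P], of smaller degree, would already vanish at [t]. *)
- move=> c; apply/negP; rewrite -dvdp_XsubCl => /dvdpP[h hE].
  have h0 : h != 0 by apply: contraNneq g0 => h0; rewrite hE h0 mul0r.
  have : g %| h.
    apply: gdvd; apply/eqP; move: gt; rewrite hE rmorphM /= hornerM => /eqP.
    rewrite mulf_eq0 => /orP[//|]; rewrite map_polyXsubC hornerXsubC subr_eq0 => /eqP tc.
    by case/negP: t1; rewrite tc; apply/vlineP; exists c.
  move/(dvdp_leq h0); rewrite hE size_mul ?polyXsubC_eq0 // size_XsubC.
  by rewrite addn2 ltnn.
have /dvdpP[h hE] := gdvd _ pt.
rewrite hE expr2 dvdp_mul2r //; apply: gdvd; apply/eqP.
move: dpt; rewrite hE derivM rmorphD !rmorphM /= hornerD !hornerM gt mulr0 add0r => /eqP.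
rewrite mulf_eq0 => /orP[//|]; rewrite -deriv_map -gE.
by rewrite (negPf (simple_root_minPoly t)).
Qed.

(** The field of definition contains all ratios of coordinates, whichever one [pt_deg] divides
    by. *)
Lemma adjoin_degree_pt_deg v i j (c := v j / v i) : v i != 0 ->
  (adjoin_degree 1 c <= pt_deg v)%N.
Proof.
move=> vi; rewrite /pt_deg; set k := odflt _ _.
have vk : v k != 0.
  by rewrite /k; case: pickP => //= /(_ i)/negbFE/eqP v0; rewrite v0 eqxx in vi.
set s := [seq _ | _ <- _].
have -> : adjoin_degree 1 c = \dim <<1; c>>%VS by rewrite dim_Fadjoin dimv1 muln1.
apply: dimvS; apply/(@FadjoinP _ _ 1%AS c <<1 & s>>%AS); split.
  exact: subv_adjoin_seq.
have sE l : v l / v k \in <<1 & s>>%AS.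
  by apply: seqv_sub_adjoin; apply: (map_f (fun l => v l / v k)); rewrite mem_enum.
have -> : c = (v j / v k) / (v i / v k).
  by rewrite /c invf_div mulrA divfK.
exact: rpred_div.
Qed.

(* In the second case the point has a parameter [t] outside [F] on the line, and
   [g] is the minimal polynomial of [t]: [t] is a double root of the restriction,
   and a simple root of [g]. *)
Lemma tangency_cases (f : {mpoly F[3]}) (d r : nat) a v :
  f \is d.-homog -> tangent_at f (fun i => val a 0 i) v -> (pt_deg v <= r)%N ->
  (exists u : proj F, [/\ dot (val a) (val u) = 0, f.@[val u 0] = 0 &
     exists2 l : F, l != 0 & forall i, f^`M(i).@[val u 0] = l * val a 0 i]) \/
  (exists g : {poly F}, [/\ (1 < size g <= r.+1)%N, forall c, ~~ root g c &
     g ^+ 2 %| restr (val a) f]).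
Proof.
move=> fd [vn0 fv0 av [lam lam0 fv']] vr.
(* A point proportional to a vector over F falls in the first case. *)
have rational s (w : 'rV[F]_3) : (forall i, v i = s * iota (w 0 i)) ->
    exists u : proj F, [/\ dot (val a) (val u) = 0, f.@[val u 0] = 0 &
     exists2 l : F, l != 0 & forall i, f^`M(i).@[val u 0] = l * val a 0 i].
  move=> vE; case: vn0 => i0 vi0.
  have s0 : s != 0 by apply: contraNneq vi0 => s0; rewrite vE s0 mul0r.
  have w0 : w != 0.
    by apply: contraNneq vi0 => w0; rewrite vE w0 mxE rmorph0 mulr0.
  have [l [u l0 wE]] := proj_of w0.
  pose s' := s * iota l.
  have s'0 : s' != 0 by rewrite mulf_neq0 // fmorph_eq0.
  have {}vE i : v i = s' * iota (val u 0 i).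
    by rewrite vE wE mxE rmorphM mulrA.
  have evalv (h : {mpoly F[3]}) e : h \is e.-homog ->
      evalL h v = s' ^+ e * iota h.@[val u 0].
    by move=> he; rewrite (eq_evalL _ vE) (evalL_homogZ _ _ he) evalL_iota.
  have key i : iota f^`M(i).@[val u 0] = lam / s' ^+ d.-1 * iota (val a 0 i).
    have := fv' i; rewrite (evalv _ _ (mderiv_homog i fd)) => e.
    by rewrite mulrAC -e mulrC mulKf // expf_neq0.
  exists u; split.
  - apply/eqP; rewrite -(fmorph_eq0 iota) -(mulrI_eq0 _ (mulfI s'0)); apply/eqP.
    rewrite -[RHS]av /dot rmorph_sum mulr_sumr; apply: eq_bigr => i _.
    by rewrite vE rmorphM mulrCA.
  - apply/eqP; rewrite -(fmorph_eq0 iota) -(mulrI_eq0 _ (mulfI (expf_neq0 d s'0))).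
    by rewrite -evalv // fv0.
  - have kp := key (pivot (val a)); rewrite proj_pivot rmorph1 mulr1 in kp.
    (* [val a] is 1 at its pivot, so the factor between gradient and line is read off there and lies
       in F. *)
    exists f^`M(pivot (val a)).@[val u 0].
      have : iota f^`M(pivot (val a)).@[val u 0] != 0.
        by rewrite kp mulf_neq0 // invr_eq0 expf_neq0.
      by rewrite fmorph_eq0.
    by move=> i; apply: (fmorph_inj iota); rewrite rmorphM [LHS]key -kp.
set i := idx1 (val a); set j := idx2 (val a).
have vE l : v l = v i * iota (line_pt1 (val a) 0 l) + v j * iota (line_pt2 (val a) 0 l).
  have [l1 l2 l3 [l4 l5 l6]] := line_ptE (val a).
  move: l; apply: (idx_case (u := val a)).
  - have := av; rewrite /on_line (sum_idx (val a)) proj_pivot rmorph1 mul1r.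
    move/eqP; rewrite addr_eq0 => /eqP ->; rewrite l3 l6 !rmorphN !mulrN -opprD.
    by rewrite ![v _ * _]mulrC.
  - by rewrite l1 l4 rmorph1 rmorph0 mulr1 mulr0 addr0.
  - by rewrite l2 l5 rmorph1 rmorph0 mulr1 mulr0 add0r.
(* This is the point at infinity of the line, defined over F. *)
have [vi0|vi0] := eqVneq (v i) 0.
  by left; apply: (rational (v j) (line_pt2 (val a))) => l; rewrite vE vi0 mul0r add0r.
set t := v j / v i.
pose w l := iota (line_pt1 (val a) 0 l) + t * iota (line_pt2 (val a) 0 l).
have {}vE l : v l = v i * w l by rewrite vE mulrDr mulrA [v i * t]mulrC divfK.
have [/vlineP[c tc]|t1] := boolP (t \in 1%VS).
  left; apply: (rational (v i) (line_pt1 (val a) + c *: line_pt2 (val a))) => l.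
  rewrite vE /w tc; move: (line_pt1 _) (line_pt2 _) => w1 w2.
  by rewrite !mxE rmorphD rmorphM.
right.
have evalv (h : {mpoly F[3]}) e : h \is e.-homog -> evalL h v = v i ^+ e * evalL h w.
  by move=> he; rewrite (eq_evalL _ vE) (evalL_homogZ _ _ he).
have restrw (h : {mpoly F[3]}) : (map_poly iota (restr (val a) h)).[t] = evalL h w.
  rewrite evalLE -[LHS]/((horner_eval t \o map_poly iota) (restr (val a) h)).
  apply: rmorph_mmap => [c|l] /=; rewrite /horner_eval ?map_polyC ?hornerC //.
  by rewrite rmorphD /= map_polyC map_polyZ map_polyX
    hornerD hornerC hornerZ hornerX /w [t * _]mulrC.
have vid e : v i ^+ e != 0 by rewrite expf_neq0.
have fw0 : evalL f w = 0.
  by apply/eqP; rewrite -(mulrI_eq0 _ (mulfI (vid d))) -evalv // fv0.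
(* By the chain rule the derivative is the gradient paired with [line_pt2]; the gradient is a
   multiple of [val a], which is orthogonal to it. *)
have dw0 : (map_poly iota (restr (val a) f)^`()).[t] = 0.
  rewrite deriv_mmap rmorph_sum horner_sum; apply/eqP.
  rewrite -(mulrI_eq0 _ (mulfI (vid d.-1))) mulr_sumr.
  rewrite (eq_bigr (fun l => lam * iota (val a 0 l * line_pt2 (val a) 0 l))).
    rewrite -mulr_sumr -rmorph_sum -/(dot _ _) dot_line_pt2 proj_pivot mulr1 subrr.
    by rewrite rmorph0 mulr0.
  move=> l _; rewrite derivD derivC add0r derivZ derivX rmorphM /= hornerM.
  rewrite -/(restr (val a) _) restrw mulrA -(evalv _ _ (mderiv_homog l fd)) fv'.
  rewrite alg_polyC map_polyC hornerC.
  by rewrite -mulrA; congr (_ * _); exact/esym/(rmorphM iota).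
have [g [szg sz1 gr gd]] := minPoly_sqr_dvd (etrans (restrw f) fw0) dw0 t1.
exists g; split=> //; rewrite sz1 szg ltnS.
exact: leq_trans (adjoin_degree_pt_deg j vi0) vr.
Qed.

End Tangency.

(** * Densities *)

Section Density.
Variable F : finFieldType.
Let q := #|F|.
Let N := #|proj F|.

(** If the jet vanishes, Euler's relation makes the omitted pivot derivative vanish too, and [u] is
    singular. *)
Lemma smooth_jet_neq0 f d (u : proj F) :
  f \is d.-homog -> smooth_curve f -> jet (val u) f != 0.
Proof.
move=> fd sf; apply/eqP => /rowP j0; set k := pivot (val u).
have fu : f.@[val u 0] = 0 by have := j0 k; rewrite !mxE eqxx.
have du i : i != k -> f^`M(i).@[val u 0] = 0.
  by move=> /negPf ik; have := j0 i; rewrite !mxE ik.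
have dk : f^`M(k).@[val u 0] = 0.
  have := euler_homog (val u 0) fd; rewrite fu mul0rn (bigD1 k) //= big1.
    by rewrite proj_pivot mulr1 addr0.
  by move=> i ik; rewrite du // mul0r.
apply: (sf (F^o : fieldExtType F) (fun i => in_alg _ (val u 0 i))).
  by exists k; rewrite fmorph_eq0 proj_pivot oner_neq0.
split=> [|i]; rewrite evalL_iota ?fu ?rmorph0 //.
by have [->|ik] := eqVneq i k; rewrite ?dk ?du ?rmorph0.
Qed.

(** The product of the finitely many rootless polynomials of bounded degree; the zero polynomial has
    roots and does not enter. *)
Lemma rootless_multiple r : exists M : {poly F}, [/\ M != 0,
  forall c, ~~ root M c & forall g : {poly F}, (size g <= r)%N ->
    (forall c, ~~ root g c) -> g %| M].
Proof.
exists (\prod_(v : 'rV[F]_r | [forall c, ~~ root (rVpoly v) c]) rVpoly v); split.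
- apply/prodf_neq0 => v /forallP/(_ 0); by apply: contraNneq => ->; rewrite root0.
- move=> c; rewrite rootE horner_prod; apply/prodf_neq0 => v /forallP/(_ c).
  by rewrite rootE.
- move=> g szg rg; rewrite (bigD1 (poly_rV g)) /= ?poly_rV_K ?dvdp_mulIl //.
  exact/forallP.
Qed.

Variables (M : {poly F}) (k : nat).
Hypotheses (M_neq0 : M != 0) (M_rootless : forall c, ~~ root M c).
Hypothesis size_M : size (M ^+ 2) = k.+1.

Definition local_data : finType :=
  ({ffun proj F -> 'rV[F]_3} * {ffun proj F -> 'rV[F]_k})%type.

Definition bad (m : 'rV[F]_k) := `[< sqdiv M (rVpoly m) >].

Definition hit (j : {ffun proj F -> 'rV[F]_3}) (a : proj F) :=
  [exists u, jet_line (val u) (j u) == Some a].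

(** What [Fle] forces on the local data: no singular F-point, and each line tangent at an F-point or
    restricting to a polynomial with a square factor from [M]. *)
Definition admissible (c : local_data) :=
  [forall u, c.1 u != 0] && [forall a, hit c.1 a || bad (c.2 a)].

Definition local (f : {mpoly F[3]})  : local_data :=
  ([ffun u => jet (val u) f], [ffun a => poly_rV (restr (val a) f %% M ^+ 2)]).

Lemma Fle_admissible r f d : f \is d.-homog -> Fle r f ->
  (forall g : {poly F}, (size g <= r.+1)%N -> (forall c, ~~ root g c) -> g %| M) ->
  admissible (local f).
Proof.
move=> fd [_ _ sf tf degf] Mr; apply/andP; split; apply/forallP => a.
  by rewrite ffunE; apply: smooth_jet_neq0 fd sf.
have Fa : F_line (fun i => val a 0 i).
  by exists (pivot (val a)); rewrite proj_pivot oner_neq0.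
have [L [v tv]] := tf _ Fa.
have [[u [au fu [l l0 fl]]]|[g [/andP[sg gr] rg gf]]] :=
    tangency_cases fd tv (degf _ Fa _ _ tv).
  apply/orP; left; apply/existsP; exists u; apply/eqP; rewrite ffunE.
  apply: (jet_lineE l0 au) => [|i ik]; first by rewrite mxE eqxx.
  by rewrite mxE (negPf ik) fl.
apply/orP; right; apply/asboolP; have gM := Mr g gr rg; exists g; split=> //.
rewrite ffunE poly_rV_K; first by rewrite -dvdp_mod // dvdp_exp2r.
by rewrite -ltnS -size_M ltn_modp expf_neq0.
Qed.

(** Once the jets are fixed, the residues on different lines are chosen independently: freely on a
    hit line, among the bad ones elsewhere. *)
Lemma card_admissible : #|[pred c | admissible c]| =
  (\sum_(j : {ffun proj F -> 'rV[F]_3} | [forall u, j u != 0%R])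
     \prod_a (if hit j a then q ^ k else #|[pred m | bad m]|))%N.
Proof.
rewrite -sum1_card /admissible.
rewrite -(pair_big_dep (fun j : {ffun proj F -> 'rV[F]_3} => [forall u, j u != 0])
  (fun j (m : {ffun proj F -> 'rV[F]_k}) => [forall a, hit j a || bad (m a)])
  (fun _ _ => 1%N)) /=.
apply: eq_bigr => j _; rewrite sum1_card.
rewrite (eq_card (B := family (fun a => [pred y | hit j a || bad y]))); last first.
  move=> m; rewrite [LHS]unfold_in; apply/forallP/familyP => h a; have := h a;
  by rewrite inE.
rewrite card_family foldrE big_image /=; apply: eq_bigr => a _.
case ha: (hit j a); last by apply: eq_card => y; rewrite !inE.
have <- : #|{: 'rV[F]_k}| = (q ^ k)%N by rewrite card_mx mul1n.
by apply: eq_card => y; rewrite !inE.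
Qed.

Variable R : realFieldType.
Let Q : R := q%:R.
Let b : R := Q ^- 2.

Lemma admissible_density :
  #|[pred c | admissible c]|%:R / #|{: local_data}|%:R
  <= (1 - Q ^- 2) ^- N * (Q^-1 + Q ^- 2 - Q ^- 3) ^+ N :> R.
Proof.
have q1 : (1 < q)%N := q_gt1 F.
have Q0 : 0 < Q by rewrite ltr0n ltnW.
have K0 : 0 < Q ^+ k by rewrite exprn_gt0.
have [b01 b1] := (invsq_itv R q1, invsq_lt1 R q1).
set B := #|[pred m | bad m]|; set G := #|[pred m | ~~ bad m]|.
have GB : (G + B = q ^ k)%N.
  have := cardC [pred m | bad m]; rewrite card_mx mul1n addnC => <-.
  by congr (_ + _)%N; apply: eq_card.
pose al : R := B%:R / Q ^+ k.
have al01 : 0 <= al <= 1.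
  rewrite divr_ge0 ?ler0n ?(ltW K0) //= ler_pdivrMr // mul1r -natrX ler_nat -GB.
  exact: leq_addl.
have adE : #|[pred c | admissible c]|%:R = (Q ^+ k) ^+ N *
   \sum_(j : {ffun proj F -> 'rV[F]_3} | [forall u, j u != 0])
     \prod_a (if hit j a then 1 else al) :> R.
  rewrite card_admissible natr_sum mulr_sumr; apply: eq_bigr => j _.
  rewrite natr_prod /N -prodr_const -big_split /=; apply: eq_bigr => a _.
  by case: ifP => _; rewrite ?mulr1 ?natrX // /al mulrCA divff ?mulr1 // gt_eqF.
have -> : #|{: local_data}|%:R =
    (Q ^+ k) ^+ N * (Q ^+ 3) ^+ N :> R.
  by rewrite card_prod !card_ffun !card_mx !mul1n natrM !natrX mulrC.
rewrite adE -mulf_div divff ?mul1r; last by rewrite expf_neq0 // gt_eqF.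
rewrite ler_pdivrMr ?exprn_gt0 //.
(* Divided by the number [Q ^+ 3] of jets at a point, [C] leaves the factor [(1 - b)^-1] of the
   final bound. *)
pose C : R := (1 - b)^-1 * Q ^+ 3.
have C0 : 0 <= C by rewrite mulr_ge0 ?exprn_ge0 ?invr_ge0 ?ltW.
(* Here [n] is [q]: a line has [q.+1] points and a point lies on [q.+1] lines. *)
have := @sum_hit_bound R (proj F) (proj F) 'rV[F]_3
  (fun u a => dot (val a) (val u) == 0) (fun u => jet_line (val u))
  (fun x => x != 0) b al C q b01 al01 C0 _ _ _ _.
move=> H; apply: le_trans (H _ _ _ _) _.
- by move=> u; exact: card_proj_perp (proj_neq0 u).
- move=> a; rewrite -[RHS](card_proj_perp (proj_neq0 a)).
  by apply: eq_card => u; rewrite !inE dotC.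
- by move=> u; exact/jet_None_weight/card_jet_line_None.
- move=> u a; have := card_jet_line_Some u a; case: ifP => _.
    exact: jet_Some_weight.
  by rewrite leqn0 => /eqP ->.
rewrite -/N exprMn mulrAC exprVn ler_wpM2r ?exprn_ge0 ?(ltW Q0) //.
rewrite ler_wpM2l ?invr_ge0 ?exprn_ge0 ?(ltW b1) //.
apply: lerXn2r; rewrite ?nnegrE.
- case/andP: al01 b01 => al0 al1 /andP[b0 _].
  have [b'0 b'1] : 0 <= 1 - b /\ 1 - b <= 1 by split; [exact: ltW | rewrite gerBl].
  have [al'0 al'1] : 0 <= 1 - al /\ 1 - al <= 1 by rewrite subr_ge0 gerBl.
  by rewrite subr_ge0 mulr_ile1 ?exprn_ge0 ?exprn_ile1.
- have Q32 : Q ^- 3 <= Q ^- 2.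
    rewrite lef_pV2 ?posrE ?exprn_gt0 // [Q ^+ 3]exprSr ler_peMr ?exprn_ge0 ?(ltW Q0) //.
    by rewrite ler1n ltnW.
 have Q1 : 0 <= Q^-1 by rewrite invr_ge0 ltW.
  by rewrite -addrA addr_ge0 // subr_ge0.
apply: (@line_weight R q q1 k G B) => //.
have := card_not_sqdiv M_neq0 M_rootless size_M.
have -> : #|[pred v : 'rV[F]_k | `[< ~ sqdiv M (rVpoly v) >]]| = G; last by [].
by apply: eq_card => y; rewrite !inE asbool_neg.
Qed.

Lemma mu_d_le r d : (2 * N + k < d)%N ->
  (forall g : {poly F}, (size g <= r.+1)%N -> (forall c, ~~ root g c) -> g %| M) ->
  ratr (mu_d (@Fle F r) d)
    <= (1 - Q ^- 2) ^- N * (Q^-1 + Q ^- 2 - Q ^- 3) ^+ N :> R.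
Proof.
move=> dk Mr; apply: le_trans admissible_density.
pose poly_of (p : Rd F d) := mpoly_of_dhomog (p : dhomog 3 F d).
have poly_ofB p p' : poly_of (p - p') = poly_of p - poly_of p' by [].
have szm (p : {poly F}) : (size (p %% M ^+ 2)%R <= k)%N.
  by rewrite -ltnS -size_M ltn_modp expf_neq0.
(* [local] is additive, and interpolation supplies a form with data [c], by which the fibre is
   translated. *)
have fib (c : local_data) :
    exists t, forall p, (local (poly_of p) == c) =
      (local (poly_of (p - t)) == local (poly_of 0)).
  have [f [fd fj fr]] := interpolation M_rootless size_M (d := d) c.1
     (m := fun a => rVpoly (c.2 a)) dk (fun a => size_rVpoly_leq _).
 exists (DHomog fd : Rd F d) => p; rewrite poly_ofB -[poly_of (DHomog fd)]/f.
 have -> : poly_of 0 = 0 by [].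
  have -> : local 0 = ([ffun=> 0], [ffun=> 0]).
    congr (_, _); apply/ffunP => a; rewrite !ffunE ?jet0 //.
    by rewrite /restr raddf0 mod0p linear0.
  case: c fj fr => c1 c2 /= fj fr.
  rewrite !xpair_eqE; congr (_ && _); apply/eqP/eqP => /ffunP e; apply/ffunP => a;
    have := e a; rewrite !ffunE.
  - by rewrite jetB fj => ->; rewrite subrr.
  - by rewrite jetB fj => /subr0_eq.
  - by rewrite restrB modpD modpN fr => <-; rewrite poly_rV_K // subrr linear0.
  - rewrite restrB modpD modpN fr raddfB /= rVpolyK => /subr0_eq; exact.
 have cardE := @card_preim_translate (Rd F d) _ (fun p => local (poly_of p))
  admissible fib.
 rewrite /mu_d fmorph_div !rmorph_nat.
have Rd0 : (0 < #|{: Rd F d}|)%N by apply/card_gt0P; exists 0.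
have B0 : (0 < #|{: local_data}|)%N.
  by apply/card_gt0P; exists (local 0).
 rewrite ler_pdivrMr ?ltr0n // mulrAC ler_pdivlMr ?ltr0n // -!natrM ler_nat.
 rewrite [X in (_ <= X)%N]mulnC -cardE leq_mul2r; apply/orP; right.
apply: subset_leq_card; apply/subsetP => p; rewrite !inE => /asboolP Ap.
apply: Fle_admissible Ap Mr.
exact: dhomog_is_dhomog.
Qed.

End Density.

Lemma mu_d_eventually_le (F : finFieldType) (R : realFieldType) r : exists d0,
  forall d, (d0 < d)%N -> ratr (mu_d (@Fle F r) d) <=
    (1 - #|F|%:R ^- 2) ^- (#|F| ^ 2 + #|F| + 1)
    * (#|F|%:R^-1 + #|F|%:R ^- 2 - #|F|%:R ^- 3) ^+ (#|F| ^ 2 + #|F| + 1) :> R.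
Proof.
(* Size at most [r.+1] means degree at most [r], the bound on the minimal polynomials. *)
have [M [M0 rM Mr]] := rootless_multiple F r.+1.
have szM : size (M ^+ 2) = (size (M ^+ 2)).-1.+1.
  by rewrite prednK // size_poly_gt0 expf_neq0.
exists (2 * #|proj F| + (size (M ^+ 2)).-1)%N => d dk.
by rewrite -(card_proj F); apply: mu_d_le rM szM _ _ _ dk Mr.
Qed.

End Forms.

(* Passage to the upper density *)
From mathcomp Require Import all_classical all_reals all_analysis.
From mathcomp Require Import Rstruct.

(** The limsup is an infimum of suprema over cofinite sets, and the tail beyond [d0] is one of
    them. *)
Lemma limn_esup_le_eventually (R : realType) (u : nat -> \bar R) (l : \bar R) d0 :
  (forall d, (d0 < d)%N -> (u d <= l)%E) -> (limn_esup u <= l)%E.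
Proof.
move=> ul; apply: le_trans (_ : ereal_sup (u @` [set d | (d0 < d)%N])%classic <= l)%E.
  apply: ereal_inf_lbound; exists [set d | (d0 < d)%N]%classic => //.
  by exists d0.+1.
by apply: ub_ereal_sup => _ [d d0d <-]; apply: ul.
Qed.

(* upper density: limsup_{d -> oo} mu_d(F_{<= r}), taken in the extended reals;
   q = #|F|; the right-hand side is
   (1 - q^-2)^-(q^2+q+1) * (q^-1 + q^-2 - q^-3)^(q^2+q+1). *)
Theorem theorem5p2 (F : finFieldType) (r : nat) (hr : (1 <= r)%N) :
  let q : Rdefinitions.R := #|F|%:R in
  let N := (#|F| ^ 2 + #|F| + 1)%N in
  (limn_esup (fun d => (ratr (mu_d (@Fle F r) d) : Rdefinitions.R)%:E)
    <= ((1 - q ^- 2) ^- N * (q ^-1 + q ^- 2 - q ^- 3) ^+ N)%:E)%E.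
Proof.
have [d0 le_d0] := Forms.mu_d_eventually_le F Rdefinitions.R r.
apply: (@limn_esup_le_eventually _ _ _ d0) => d d0d.
by rewrite lee_fin; apply: le_d0.
Qed.
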